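(* There exist universal constants $c_1, C, C'>0$ such that the following holds. Let $\bm{M}^\star\in\mathbb{R}^{n\times n}$ be a rank-$r$ symmetric matrix with incoherence parameter $\mu$ and nonzero eigenvalues $\lambda_{\max}^\star=|\lambda_1^\star|\ge\cdots\ge|\lambda_r^\star|=\lambda_{\min}^\star>0$, and put $\kappa=\lambda_{\max}^\star/\lambda_{\min}^\star$. Let $\bm{M}=\bm{M}^\star+\bm{H}$, where the random matrix $\bm{H}$ satisfies the noise assumption with parameters $\sigma,B$ (see context), and suppose $$\frac{\max\{\sigma\sqrt{n\log n},\,B\log n\}}{\lambda_{\max}^\star}\le\frac{c_1}{\kappa^2}.$$ Let $1\le l\le r$ and let $\lambda_l$ be the $l$-th of the top-$r$ eigenvalues of $\bm{M}$. Then with probability at least $1-C'n^{-10}$ there exists $1\le j\le r$ such that $$|\lambda_l-\lambda_j^\star|\le C\max\{\sigma\sqrt{n\log n},\,B\log n\}\,\kappa r\sqrt{\frac{\mu}{n}}.$$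
   Context: Noise assumption with parameters $\sigma=\sigma_n\ge 0$, $B=B_n>0$ on a random matrix $\bm{H}=[H_{ij}]\in\mathbb{R}^{n\times n}$: (1) the entries $H_{ij}$, $1\le i,j\le n$, are independent (no symmetry is imposed, and they need not be identically distributed); (2) $\mathbb{E}[H_{ij}]=0$; (3) $\mathrm{Var}(H_{ij})\le\sigma^2$; (4) each $H_{ij}$ satisfies either (a) $|H_{ij}|\le B$, or (b) $H_{ij}$ has a symmetric distribution with $\mathbb{P}\{|H_{ij}|>B\}\le c_{\mathrm b}n^{-12}$, where $c_{\mathrm b}>0$ is a fixed universal constant. Incoherence parameter: with eigen-decomposition $\bm{M}^\star=\bm{U}^\star\bm{\Sigma}^\star\bm{U}^{\star\top}$, where $\bm{U}^\star\in\mathbb{R}^{n\times r}$ has orthonormal columns (the eigenvectors) and $\bm{\Sigma}^\star=\mathrm{diag}(\lambda_1^\star,\dots,\lambda_r^\star)$, $\mu$ is the smallest number such that every entry of $\bm{U}^\star$ has magnitude at most $\sqrt{\mu/n}$. The top-$r$ eigenvalues of the (generally asymmetric) matrix $\bm{M}$ are the $r$ (possibly complex) eigenvalues of largest modulus, ordered so that $|\lambda_1|\ge\cdots\ge|\lambda_r|$. *)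

(* Defs.v *)
From HB Require Import structures.
From mathcomp Require Import all_boot all_order all_algebra.
From mathcomp Require Import all_classical all_reals all_analysis.
From mathcomp Require Import complex.

Set Implicit Arguments.
Unset Strict Implicit.
Unset Printing Implicit Defensive.

Import Order.TTheory GRing.Theory Num.Theory.
Import numFieldNormedType.Exports.

Local Open Scope classical_set_scope.
Local Open Scope ring_scope.
Local Open Scope complex_scope.

Definition mutually_independent (d : measure_display) (Omega : measurableType d)
    (R : realType) (P : probability Omega R) (I : finType)
    (X : I -> {RV P >-> R}) : Prop :=
  forall (J : {set I}) (A : I -> set R),
    (forall i, measurable (A i)) ->
    P (\bigcap_(i in [set` J]) (X i @^-1` A i)) =
      (\prod_(i in J) P (X i @^-1` A i))%E.

Definition symmetric_distribution (d : measure_display)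
    (Omega : measurableType d) (R : realType) (P : probability Omega R)
    (X : {RV P >-> R}) : Prop :=
  forall A : set R, measurable A ->
    P (X @^-1` A) = P [set w | A (- X w)].

(* Since +oo - +oo = -oo in \bar R, a vanishing expectation forces
   integrability. *)
Definition noise_assumption (d : measure_display) (Omega : measurableType d)
    (R : realType) (P : probability Omega R) (cb : R) (n : nat) (sigma B : R)
    (H : 'I_n -> 'I_n -> {RV P >-> R}) : Prop :=
  [/\ mutually_independent (fun ij : 'I_n * 'I_n => H ij.1 ij.2),
      forall i j, ('E_P[H i j] = 0)%E,
      forall i j, ('V_P[H i j] <= (sigma ^+ 2)%:E)%E
    & forall i j,
        {ae P, forall w, `|H i j w| <= B} \/
        (symmetric_distribution (H i j) /\
         (P [set w | (B < `|H i j w|)%R] <= (cb / n%:R ^+ 12)%:E)%E)].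

(* The diagonal of Sigma lists the nonzero eigenvalues, with multiplicity. *)
Definition eigen_decomposition (R : realType) (n r : nat) (A : 'M[R]_n)
    (U : 'M[R]_(n, r)) (lam : r.-tuple R) : Prop :=
  [/\ U^T *m U = 1%:M,
      A = U *m diag_mx (\row_j tnth lam j) *m U^T,
      forall j, tnth lam j != 0
    & sorted (fun x y => `|y| <= `|x|) lam].

Definition incoherence_bound (R : realType) (n r : nat) (U : 'M[R]_(n, r))
    (mu : R) : Prop :=
  0 <= mu /\ forall i j, `|U i j| <= Num.sqrt (mu / n%:R).

Definition incoherence_parameter (R : realType) (n r : nat) (U : 'M[R]_(n, r))
    (mu : R) : Prop :=
  incoherence_bound U mu /\
  forall mu' : R, incoherence_bound U mu' -> mu <= mu'.

(* Eigenvalues are counted with algebraic multiplicity: s completes t to the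
   full list of roots of the characteristic polynomial.  Ties in modulus (such
   as conjugate pairs) may be broken arbitrarily, so t need not be unique. *)
Definition top_eigenvalues (R : realType) (n r : nat) (A : 'M[R]_n)
    (t : r.-tuple R[i]) : Prop :=
  exists s : seq R[i],
    char_poly (map_mx (real_complex R) A) =
      \prod_(z <- t ++ s) ('X - z%:P) /\
    sorted (fun x y => `|y| <= `|x|) (t ++ s).

Definition noise_level (R : realType) (n : nat) (sigma B : R) : R :=
  Num.max (sigma * Num.sqrt (n%:R * ln n%:R)) (B * ln n%:R).

(* Main.v *)
Require Import Defs.
From HB Require Import structures.
From mathcomp Require Import all_boot all_order all_algebra.
From mathcomp Require Import all_classical all_reals all_analysis.
From mathcomp Require Import measurable_realfun.
From mathcomp Require Import complex.
From mathcomp Require Import ring lra zify.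

(** Write N for the noise level and X for H truncated at B.

    Moments.  Expanding E (u^T X^s v)^p over p walks of s steps, independence
    and centering kill every word in which some directed edge occurs once.  A
    surviving word with e distinct edges has expectation at most
    sigma^(2e) B^(ps - 2e), and once the pattern of coincidences among the edges
    is fixed, a word is determined by the heads of its e distinct edges and by
    the starts of edges that are only used as first steps; each of the latter is
    shared by two walks, so that it contributes sum_i u_i^2 <= 1.  Hence there
    are effectively n^e words per pattern, and summing over patterns gives, with
    q = p s and |u|_2 = 1,
    E (u^T X^s v)^p <= |v|_oo^p (C max (sigma sqrt (n q), q B))^q.
    Taking q of order log n and applying Markov's inequality bounds, for
    1 <= s <= 2 s0 with s0 of order log n, the entries of X^s by (C N)^s and
    those of U^T X^s U by (C N)^s sqrt (mu / n).  Submultiplicativity extends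
    this to all s; no bound on the operator norm of X is needed.

    Spectrum.  Let phi_s(x) = x H^s U.  For an eigenvalue z of M with
    |z| >= lmin / 8, iterating the eigenvalue equation gives
    (z - Sigma) phi_0 = sum_(s >= 1) z^(-s) (U^T H^s U) Sigma phi_0, which bounds
    the distance from z to some lambda_j.  That the r largest eigenvalues do
    satisfy |z| >= lmin / 8 follows from a cone argument: M - z preserves the cone
    |phi_s| <= tau^s |phi_0| <> 0 whenever |z| <= lmin / 8, so the product of the
    M - z over all small eigenvalues z kills no nonzero vector of the row space
    of U^T, while its rank is at most n minus the number of such z.  The cone
    needs C N kappa max(1, r sqrt (mu / n)) <= lmin; when this fails, the claimed
    error bound exceeds 2 lmin and eigenvalues below lmin / 8 are harmless. *)

Set Implicit Arguments.
Unset Strict Implicit.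
Unset Printing Implicit Defensive.

Import Order.TTheory GRing.Theory Num.Theory.
Import numFieldNormedType.Exports.

Local Open Scope ring_scope.
Local Open Scope complex_scope.

(** * Invariant subspaces and the characteristic polynomial *)

Fixpoint shift_prod (F : pzRingType) (n : nat) (A : 'M[F]_n) (zs : seq F) :
    'M[F]_n :=
  if zs is z :: zs' then shift_prod A zs' *m (A - z%:M) else 1%:M.

Lemma shift_prod_conj (F : fieldType) (n : nat) (P A T : 'M[F]_n) (zs : seq F) :
  P *m A = T *m P -> P *m shift_prod A zs = shift_prod T zs *m P.
Proof.
move=> PA; elim: zs => [|z zs IH] /=; first by rewrite mulmx1 mul1mx.
rewrite mulmxA IH -!mulmxA; congr (_ *m _).
by rewrite mulmxBr mulmxBl PA mul_scalar_mx mul_mx_scalar.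
Qed.

Lemma char_poly_conj (F : fieldType) (n : nat) (P A T : 'M[F]_n) :
  P \in unitmx -> P *m A = T *m P -> char_poly A = char_poly T.
Proof.
move=> uP PA; rewrite /char_poly /char_poly_mx.
set Q := map_mx polyC P.
have QA : Q *m ('X%:M - map_mx polyC A) = ('X%:M - map_mx polyC T) *m Q.
  by rewrite mulmxBr mulmxBl -!map_mxM PA mul_scalar_mx mul_mx_scalar.
have Q0 : \det Q != 0.
  by rewrite det_map_mx polyC_eq0 -unitfE -unitmxE.
by apply: (mulfI Q0); rewrite -det_mulmx QA det_mulmx mulrC.
Qed.

Lemma char_poly_lblock (F : fieldType) (n : nat) (a : F) (c : 'cV[F]_n)
    (A : 'M[F]_n) :
  char_poly (block_mx a%:M 0 c A : 'M[F]_(1 + n)) = ('X - a%:P) * char_poly A.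
Proof.
rewrite /char_poly /char_poly_mx map_block_mx.
rewrite (_ : 'X%:M = block_mx 'X%:M 0 0 'X%:M :> 'M[{poly F}]_(1 + n)); last first.
  by rewrite -scalar_mx_block.
rewrite opp_block_mx add_block_mx map_mx0 subr0 det_lblock; congr (_ * _).
by rewrite [X in \det X]mx11_scalar det_scalar1 !mxE eqxx.
Qed.

(** A left eigenvector is completed to a basis: [v] is a multiple of the first row of [row_ebase v],
    so in this basis the first row of [A] becomes [z] times the first unit vector. This deflates one
    root. *)
Lemma eigenvalue_lblock (F : fieldType) (n : nat) (A : 'M[F]_(1 + n)) (z : F) :
  root (char_poly A) z ->
  exists P c A', P \in unitmx /\
    P *m A = (block_mx z%:M 0 c A' : 'M[F]_(1 + n)) *m P.
Proof.
rewrite -eigenvalue_root_char => /eigenvalueP[v vA v0].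
set P := row_ebase v.
have uP : P \in unitmx := row_ebase_unit v.
have [a a0 Pv] : exists2 a, a != 0 & v = a *: usubmx P.
  have := mulmx_ebase v; rewrite rank_rV v0 /= => <-.
  exists (col_ebase v 0 0).
    have := col_ebase_unit v.
    by rewrite [col_ebase v]mx11_scalar unitmxE det_scalar1 unitfE mxE eqxx mulr1n.
  rewrite [col_ebase v]mx11_scalar mul_scalar_mx -scalemxAl mxE eqxx mulr1n.
  congr (_ *: _); rewrite -/P -[in LHS](vsubmxK P).
  rewrite (_ : pid_mx 1 = row_mx 1%:M 0 :> 'M[F]_(1, 1 + n)).
    by rewrite mul_row_col mul1mx mul0mx addr0.
  by rewrite pid_mx_row.
exists P; set T := P *m A *m invmx P.
exists (dlsubmx T), (drsubmx T); split=> //.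
have eT : usubmx T = row_mx z%:M 0.
  rewrite /T -!mul_usub_mx.
  have -> : usubmx P *m A = z *: usubmx P.
    by apply: (scalerI a0); rewrite scalemxAl -Pv vA scalerA mulrC -scalerA -Pv.
  rewrite -scalemxAl mul_usub_mx mulmxV // scalar_mx_block.
  by rewrite block_mxEv col_mxKu scale_row_mx scaler0 scalemx1.
have -> : block_mx z%:M 0 (dlsubmx T) (drsubmx T) = T.
  by rewrite -[RHS]vsubmxK eT block_mxEv hsubmxK.
by rewrite mulmxKV.
Qed.

(** Induction by deflation, which handles repeated roots without any diagonalizability. In the
    adapted basis all shifts are block lower triangular and the shift by [z] has zero first row, so
    the product is a zero row above rows left-multiplied by the product for the smaller block
    [A']. *)
Lemma mxrank_shift_prod (F : fieldType) (n : nat) (A : 'M[F]_n) (zs : seq F)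
    (q : {poly F}) :
  char_poly A = \prod_(z <- zs) ('X - z%:P) * q ->
  (\rank (shift_prod A zs) + size zs <= n)%N.
Proof.
elim: zs n A => [|z zs IH] n A; first by rewrite addn0 rank_leq_row.
rewrite big_cons -mulrA => cA.
have rz : root (char_poly A) z by rewrite cA rootM root_XsubC eqxx.
case: n A cA rz => [|n] A cA rz.
  by move: rz; rewrite /char_poly det_mx00 rootE hornerC oner_eq0.
have [P [c [A' [uP PA]]]] := @eigenvalue_lblock _ n A z rz.
rewrite (char_poly_conj uP PA) char_poly_lblock in cA.
have {}cA : char_poly A' = \prod_(z <- zs) ('X - z%:P) * q.
  by apply: mulfI cA; rewrite polyXsubC_eq0.
have {}IH := IH _ _ cA; rewrite /= addnS ltnS.
apply: leq_trans IH; rewrite leq_add2r.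
have -> : \rank (shift_prod A zs *m (A - z%:M)) =
          \rank (P *m shift_prod A (z :: zs)).
  have fP : row_full P by rewrite row_full_unit.
  by rewrite (eqmxMfull (shift_prod A (z :: zs)) fP).
rewrite (shift_prod_conj _ PA) mxrankMfree ?row_free_unit //=.
have -> : block_mx z%:M 0 c A' - z%:M = block_mx 0 0 c (A' - z%:M) :> 'M[F]_(1 + n).
  by rewrite (@scalar_mx_block _ 1 n) opp_block_mx add_block_mx !subr0 subrr.
have [a [d ->]] : exists a d, shift_prod (block_mx z%:M 0 c A' : 'M[F]_(1 + n)) zs =
   block_mx a 0 d (shift_prod A' zs) :> 'M[F]_(1 + n).
  elim: (zs) => [|y ys [a [d /= ->]]] /=.
    by exists 1%:M, 0; rewrite -scalar_mx_block.
  rewrite (@scalar_mx_block _ 1 n) opp_block_mx add_block_mx mulmx_block.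
  by rewrite !subr0 !mul0mx !mulmx0 !addr0 !add0r; eexists; eexists.
rewrite mulmx_block !mul0mx !mulmx0 !add0r.
rewrite block_mxEv row_mx0 rank_col_0mx.
by rewrite -mul_mx_row mxrankM_maxl.
Qed.

(** * Low-rank matrices perturbed by a matrix with controlled powers *)

Section L1Norm.
Variable R : rcfType.
Local Notation normc := (@Normc.normc R).

Lemma normc_ge0 (z : R[i]) : 0 <= normc z.
Proof. by case: z => a b; rewrite sqrtr_ge0. Qed.

Lemma normrc (z : R[i]) : `|z| = (normc z)%:C.
Proof. by case: z. Qed.

Lemma normcB (x y : R[i]) : normc (x - y) <= normc x + normc y.
Proof. by rewrite -(normcN y); exact: le_normcD. Qed.

Lemma normc_real (a : R) : normc a%:C = `|a|.
Proof. by rewrite /= expr0n /= addr0 sqrtr_sqr. Qed.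

Lemma normc_sum (I : finType) (f : I -> R[i]) :
  normc (\sum_i f i) <= \sum_i normc (f i).
Proof.
elim/big_ind2: _ => //; first by rewrite Normc.normc0.
by move=> x a y b xa yb; apply: le_trans (le_normcD _ _) (lerD xa yb).
Qed.

(** In this norm an entrywise bound [g] on a matrix with [p] columns bounds its action on row
    vectors by [p * g]; on [r] by [r] matrices this yields the factor [r] of the final error. *)
Definition l1 (m : nat) (x : 'rV[R[i]]_m) : R := \sum_j normc (x 0 j).

Lemma l1_ge0 m (x : 'rV_m) : 0 <= l1 x.
Proof. by apply: sumr_ge0 => j _; apply: normc_ge0. Qed.

Lemma l1_eq0 m (x : 'rV_m) : l1 x = 0 -> x = 0.
Proof.
move=> x0; apply/rowP => j; rewrite mxE; apply: Normc.eq0_normc.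
by apply: (psumr_eq0P _ x0) => // i _; apply: normc_ge0.
Qed.

Lemma l1_gt0 m (x : 'rV_m) : x != 0 -> 0 < l1 x.
Proof.
by move=> x0; rewrite lt_def l1_ge0 andbT; apply: contra x0 => /eqP/l1_eq0->.
Qed.

Lemma l1D m (x y : 'rV_m) : l1 (x + y) <= l1 x + l1 y.
Proof.
rewrite /l1 -big_split /=; apply: ler_sum => j _; rewrite mxE; exact: le_normcD.
Qed.

Lemma l1Z m z (x : 'rV_m) : l1 (z *: x) = normc z * l1 x.
Proof.
by rewrite /l1 mulr_sumr; apply: eq_bigr => j _; rewrite mxE Normc.normcM.
Qed.

Lemma l1N m (x : 'rV_m) : l1 (- x) = l1 x.
Proof. by apply: eq_bigr => j _; rewrite mxE normcN. Qed.

Lemma l1_mulmx m p (x : 'rV_m) (G : 'M[R[i]]_(m, p)) (g : R) :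
  (forall i j, normc (G i j) <= g) -> l1 (x *m G) <= p%:R * g * l1 x.
Proof.
move=> hG.
have -> : p%:R * g * l1 x = \sum_(j < p) g * l1 x.
  by rewrite sumr_const card_ord mulr_natl mulrnAl.
apply: ler_sum => j _; rewrite mxE; apply: le_trans (normc_sum _) _.
rewrite /l1 mulr_sumr; apply: ler_sum => i _.
by rewrite Normc.normcM mulrC ler_wpM2r // normc_ge0.
Qed.

Lemma l1_mul_diag_le m (x d : 'rV_m) (b : R) :
  (forall j, normc (d 0 j) <= b) -> l1 (x *m diag_mx d) <= b * l1 x.
Proof.
move=> hd; rewrite /l1 mulr_sumr; apply: ler_sum => j _.
by rewrite mul_mx_diag mxE Normc.normcM mulrC ler_wpM2r // normc_ge0.
Qed.

Lemma l1_mul_diag_ge m (x d : 'rV_m) (b : R) :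
  (forall j, b <= normc (d 0 j)) -> b * l1 x <= l1 (x *m diag_mx d).
Proof.
move=> hd; rewrite /l1 mulr_sumr; apply: ler_sum => j _.
by rewrite mul_mx_diag mxE Normc.normcM mulrC ler_wpM2l // normc_ge0.
Qed.

End L1Norm.

(** Stands in for a limit: remainders that halve at each step are discarded by an archimedean choice
    of [m]. *)
Lemma le_add_pow2 (R : archiRealFieldType) (x y c : R) (m0 : nat) :
  (forall m, (m0 <= m)%N -> x <= y + c / 2 ^+ m) -> x <= y.
Proof.
move=> h; rewrite leNgt; apply/negP => yx.
have d0 : 0 < x - y by rewrite subr_gt0.
set m := maxn m0 (Num.bound (c / (x - y))).
have bm : c / (x - y) < 2 ^+ m.
  have [c0|c0] := leP 0 (c / (x - y)); last first.
    by apply: lt_trans c0 _; rewrite exprn_gt0.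
  apply: lt_le_trans (archi_boundP c0) _.
  rewrite -natrX ler_nat; apply: leq_trans (ltnW (ltn_expl _ (ltnSn 1))).
  exact: leq_maxr.
have := h m (leq_maxl _ _); rewrite leNgt => /negP; apply.
rewrite -ltrBrDl ltr_pdivrMr ?exprn_gt0 // mulrC -ltr_pdivrMr //.
Qed.

(** * Cone argument and localization of large eigenvalues *)

Section Spiked.
Variables (R : realType) (n r : nat).
Local Notation normc := (@Normc.normc R).
Variables (H : 'M[R[i]]_n) (W : 'M[R[i]]_(n, r)) (WT : 'M[R[i]]_(r, n)).
Variables (d : 'rV[R[i]]_r) (k V lmin lmax : R).
Hypotheses (WTW : WT *m W = 1%:M) (k_gt0 : 0 < k) (V_ge0 : 0 <= V).
Hypothesis dmin : forall j, lmin <= normc (d 0 j).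
Hypothesis dmax : forall j, normc (d 0 j) <= lmax.
Hypothesis WHW : forall s i j, (0 < s)%N ->
  normc ((WT *m H ^+ s *m W) i j) <= k ^+ s * V.

Let M := W *m diag_mx d *m WT + H.
Let phi s (x : 'rV[R[i]]_n) := x *m H ^+ s *m W.
Let delta := r%:R * V.

(** [M - H] factors through [W], so multiplication by [M] shifts the index [s] by one, up to a term
    that sees [x] only through [phi 0 x]. *)
Lemma phi_mulM s x :
  phi s (x *m M) = phi 0 x *m diag_mx d *m (WT *m H ^+ s *m W) + phi s.+1 x.
Proof.
rewrite /phi /M exprS expr0 -mulmxE mulmx1 mulmxDr !mulmxDl !mulmxA.
by [].
Qed.

Lemma l1_mulG s (y : 'rV[R[i]]_r) : (0 < s)%N ->
  l1 (y *m (WT *m H ^+ s *m W)) <= delta * k ^+ s * l1 y.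
Proof.
move=> s0; apply: le_trans (l1_mulmx _ (fun i j => WHW i j s0)) _.
by rewrite /delta -!mulrA (mulrCA V).
Qed.

Lemma delta_ge0 : 0 <= delta. Proof. by rewrite mulr_ge0. Qed.

Lemma l1_phi_mulM s x : (0 < s)%N ->
  l1 (phi s (x *m M)) <=
    delta * lmax * k ^+ s * l1 (phi 0 x) + l1 (phi s.+1 x).
Proof.
move=> s0; rewrite phi_mulM; apply: le_trans (l1D _ _) _; rewrite lerD2r.
apply: le_trans (l1_mulG _ s0) _.
have -> : delta * lmax * k ^+ s * l1 (phi 0 x) =
    delta * k ^+ s * (lmax * l1 (phi 0 x)) by ring.
apply: ler_wpM2l; last exact: l1_mul_diag_le.
by rewrite mulr_ge0 ?delta_ge0 ?exprn_ge0 ?ltW.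
Qed.

Definition cone (tau : R) (x : 'rV[R[i]]_n) :=
  phi 0 x != 0 /\ forall s, l1 (phi s x) <= tau ^+ s * l1 (phi 0 x).

(** The low-rank part dominates: the size of [phi 0] is multiplied by at least [lmin - tau - rho],
    while the bound [tau ^+ s] times that size for [phi s] is multiplied by at most
    [lmin / 4 + tau + rho]. Under the hypotheses on [tau] and [rho] the value [5 * lmin / 8]
    separates the two factors. *)
Lemma cone_step (tau rho : R) (z : R[i]) (x : 'rV_n) :
  k <= tau -> delta * lmax * k <= tau * (lmin / 4) -> 4 * tau <= lmin ->
  8 * rho <= lmin -> normc z <= rho ->
  cone tau x -> cone tau (x *m (M - z%:M)).
Proof.
move=> ktau hd ht hr zr [x0 hx].
have a0 := l1_gt0 x0; set a := l1 _ in hx a0.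
have tau0 : 0 < tau by apply: lt_le_trans ktau.
have lmax0 : 0 <= lmax.
  by have /rV0Pn[j _] := x0; apply: le_trans (normc_ge0 _) (dmax j).
have phiE s : phi s (x *m (M - z%:M)) = phi s (x *m M) - z *: phi s x.
  by rewrite /phi mulmxBr !mulmxBl mul_mx_scalar -!scalemxAl.
have low : (lmin - tau - rho) * a <= l1 (phi 0 (x *m (M - z%:M))).
  rewrite phiE phi_mulM expr0 mulmx1 WTW mulmx1.
  set q := l1 _.
  have : lmin * a <= l1 (phi 0 x *m diag_mx d) by apply: l1_mul_diag_ge.
  have : l1 (phi 0 x *m diag_mx d) <= q + l1 (phi 1 x) + rho * a.
    have -> : phi 0 x *m diag_mx d =
        (phi 0 x *m diag_mx d + phi 1 x - z *: phi 0 x) - phi 1 x + z *: phi 0 x.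
      by rewrite addrAC subrK addrK.
    apply: le_trans (l1D _ _) _; apply: lerD.
      by apply: le_trans (l1D _ _) _; rewrite l1N.
    by rewrite l1Z ler_wpM2r // ltW.
  have := hx 1%N; rewrite expr1.
  set u := l1 (phi 1 x); set v := l1 (_ *m _) => *.
  by rewrite !mulrBl; lra.
split.
  apply/eqP => p0; move: low; rewrite p0.
  rewrite (_ : l1 0 = 0); last first.
    by rewrite /l1 big1 // => j _; rewrite mxE Normc.normc0.
  rewrite leNgt mulr_gt0 //; lra.
case=> [|s]; first by rewrite expr0 mul1r.
apply: le_trans (ler_wpM2l (exprn_ge0 _ (ltW tau0)) low).
rewrite phiE; apply: le_trans (l1D _ _) _; rewrite l1N l1Z.
have h1 := l1_phi_mulM x (ltn0Sn s).
have h2 := hx s.+2; have h3 := hx s.+1.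
have h4 : normc z * l1 (phi s.+1 x) <= rho * (tau ^+ s.+1 * a).
  by apply: ler_pM => //; rewrite ?normc_ge0 ?l1_ge0.
have h5 : delta * lmax * k ^+ s.+1 <= tau ^+ s.+1 * (lmin / 4).
  have -> : delta * lmax * k ^+ s.+1 = delta * lmax * k * k ^+ s.
    by rewrite exprS; ring.
  have -> : tau ^+ s.+1 * (lmin / 4) = tau * (lmin / 4) * tau ^+ s.
    by rewrite exprS; ring.
  by apply: ler_pM; rewrite ?mulr_ge0 ?delta_ge0 ?exprn_ge0 ?lerXn2r ?nnegrE //
    ltW.
have h6 := ler_wpM2r (ltW a0) h5.
have h7 : tau ^+ s.+2 * a = tau * (tau ^+ s.+1 * a) by rewrite exprS mulrA.
rewrite h7 in h2; rewrite -/a in h1.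
have : tau ^+ s.+1 * (lmin / 4) * a = lmin / 4 * (tau ^+ s.+1 * a) by ring.
move=> h8; rewrite h8 in h6.
have -> : tau ^+ s.+1 * ((lmin - tau - rho) * a) =
   (lmin - tau - rho) * (tau ^+ s.+1 * a) by ring.
set T := tau ^+ s.+1 * a in h2 h4 h6 *.
have T0 : 0 <= T by rewrite mulr_ge0 ?exprn_ge0 ?ltW.
set y1 := l1 (phi s.+1 (x *m M)) in h1 *.
apply: (@le_trans _ _ ((lmin / 4 + tau + rho) * T)); first by rewrite !mulrDl; lra.
by rewrite ler_wpM2r //; lra.
Qed.

Lemma cone_init (tau : R) (c : 'rV_r) :
  k <= tau -> delta * k <= tau -> c != 0 -> cone tau (c *m WT).
Proof.
move=> ktau dtau c0.
have p0 : phi 0 (c *m WT) = c by rewrite /phi expr0 mulmx1 -mulmxA WTW mulmx1.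
rewrite /cone p0; split=> // -[|s]; first by rewrite expr0 mul1r p0.
rewrite /phi -!mulmxA mulmxA -mulmxA (mulmxA WT).
apply: le_trans (l1_mulG _ (ltn0Sn s)) _; rewrite ler_wpM2r ?l1_ge0 //.
rewrite exprS mulrA (exprS tau); apply: ler_pM => //.
- by rewrite mulr_ge0 ?delta_ge0 ?ltW.
- by rewrite exprn_ge0 ?ltW.
- by rewrite lerXn2r ?nnegrE // ltW // (lt_le_trans k_gt0).
Qed.

(** Dimension count: if the eigenvalue at position [l] were small, so would be the [n - l]
    eigenvalues from there on, and the product of their shifts would have rank at most [l < r]. It
    would then kill a nonzero vector of the row space of [WT]; but that vector lies in the cone,
    which the shifts preserve and which omits 0. *)
Lemma top_eigenvalue_gt (tau rho : R) (t : r.-tuple R[i]) (s : seq R[i])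
    (l : 'I_r) :
  k <= tau -> delta * k <= tau ->
  delta * lmax * k <= tau * (lmin / 4) -> 4 * tau <= lmin ->
  8 * rho <= lmin ->
  char_poly M = \prod_(z <- t ++ s) ('X - z%:P) ->
  sorted (fun x y : R[i] => `|y| <= `|x|) (t ++ s) ->
  rho < normc (tnth t l).
Proof.
move=> ktau dtau hd ht hr cM st; rewrite ltNge; apply/negP => tl.
set zs := drop l (t ++ s).
have szts : size (t ++ s) = n.
  have := size_char_poly M; rewrite cM size_prod_XsubC; exact: succn_inj.
have szs : size zs = (n - l)%N by rewrite size_drop szts.
have ln : (l < n)%N.
  by rewrite -szts size_cat size_tuple; apply: leq_trans (ltn_ord l) (leq_addr _ _).
have hz z : z \in zs -> normc z <= rho.
  move=> /(nthP 0)[i hi <-]; rewrite nth_drop.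
  apply: le_trans tl; rewrite (tnth_nth 0) -lecR -!normrc.
  have -> : t`_l = (t ++ s)`_l by rewrite nth_cat size_tuple ltn_ord.
  have tr : transitive (fun x y : R[i] => `|y| <= `|x|).
    by move=> x y w h1 h2; apply: le_trans h1.
  apply: (sorted_leq_nth tr _ _ st) => //; rewrite ?inE ?szts ?leq_addr //.
  by rewrite -ltn_subRL -szs.
have rk : (\rank (shift_prod M zs) + size zs <= n)%N.
  apply: (@mxrank_shift_prod _ _ _ _ (\prod_(z <- take l (t ++ s)) ('X - z%:P))).
  by rewrite cM -{1}(cat_take_drop l (t ++ s)) big_cat /= mulrC.
have /negP[] : ~~ row_free (WT *m shift_prod M zs).
  rewrite /row_free neq_ltn; apply/orP; left.
  apply: leq_ltn_trans (mxrankM_maxr _ _) _.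
  rewrite -(ltn_add2r (size zs)); apply: leq_ltn_trans rk _.
  by rewrite szs addnBA ?(ltnW ln) // ltn_subRL ltn_add2r.
rewrite -kermx_eq0; apply/eqP/row_matrixP => i; rewrite row0.
apply/eqP/negPn/negP => c0.
set c := row i _ in c0.
have ck : c *m (WT *m shift_prod M zs) = 0.
  by apply/sub_kermxP; rewrite row_sub.
move: ck; clearbody c.
have : cone tau (c *m WT *m shift_prod M zs).
  elim: zs hz {szs rk i} => [|z zs IH] hz /=.
    by rewrite mulmx1; apply: cone_init.
  rewrite mulmxA; apply: (cone_step ktau hd ht hr).
    by apply: hz; rewrite mem_head.
  by apply: IH => // y yz; apply: hz; rewrite inE yz orbT.
rewrite mulmxA => -[+ _] => /negP h0 h1; apply: h0.
by rewrite h1 /phi !mul0mx.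
Qed.

(** Bounds [phi 1 v] from above by unrolling the eigenvalue equation, and compares with its exact
    value in terms of [phi 0 v]. The constant [C] enters only through vanishing remainders, so the
    tail bounds may be crude. *)
Lemma eigenvalue_near (C : R) (s0 : nat) (z : R[i]) (v : 'rV_n) :
  (forall s, (s0 <= s)%N -> l1 (v *m H ^+ s) <= C * k ^+ s) ->
  (forall s, (s0 <= s)%N -> l1 (v *m H ^+ s *m W) <= C * k ^+ s) ->
  v *m M = z *: v -> v != 0 -> 2 * k <= normc z ->
  exists j : 'I_r, normc (z - d 0 j) <= 2 * delta * lmax * k / normc z.
Proof.
move=> tail1 tail2 vM v0 hz.
set a := normc z in hz *.
have a0 : 0 < a by apply: lt_le_trans hz; rewrite mulr_gt0.
have ka : k / a <= 1 / 2.
  by rewrite ler_pdivrMr //; lra.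
have ka0 : 0 <= k / a by rewrite divr_ge0 // ltW.
have kXa m : (k / a) ^+ m <= 1 / 2 ^+ m.
  have -> : 1 / 2 ^+ m = (1 / 2) ^+ m :> R by rewrite expr_div_n expr1n.
  by rewrite lerXn2r ?nnegrE // divr_ge0.
(* If [phi 0 v] vanished, [v] would be a left eigenvector of [H] for [z], and [v *m H ^+ s] would
   have size [a ^+ s * l1 v], against [tail1] because [2 * k <= a]. *)
have p0 : phi 0 v != 0.
  apply/negP => /eqP; rewrite /phi expr0 mulmx1 => vW.
  have vH : v *m H = z *: v by rewrite -vM /M mulmxDr !mulmxA vW !mul0mx add0r.
  have vHs s : v *m H ^+ s = z ^+ s *: v.
    elim: s => [|s IH]; first by rewrite !expr0 mulmx1 scale1r.
    by rewrite exprSr -mulmxE mulmxA IH -scalemxAl vH scalerA -exprSr.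
  have : l1 v <= 0.
    apply: (@le_add_pow2 _ _ _ C s0) => m hm; rewrite add0r.
    have := tail1 m hm; rewrite vHs l1Z.
    have -> : normc (z ^+ m) = a ^+ m.
      elim: (m) => [|i IH]; first by rewrite !expr0 Normc.normc1.
      by rewrite !exprS Normc.normcM IH.
    rewrite mulrC -ler_pdivlMr ?exprn_gt0 // -mulrA -expr_div_n => h.
    have C0 : 0 <= C.
      by have := le_trans (l1_ge0 _) (tail1 m hm); rewrite pmulr_lge0 ?exprn_gt0.
    apply: le_trans h _; apply: ler_wpM2l => //; rewrite -[leRHS]mul1r.
    exact: kXa.
  by rewrite leNgt (l1_gt0 v0).
set b := l1 (phi 0 v).
have b0 : 0 < b by apply: l1_gt0.
have zphi s : z *: phi s v =
    phi 0 v *m diag_mx d *m (WT *m H ^+ s *m W) + phi s.+1 v.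
  by rewrite -phi_mulM vM /phi -!scalemxAl.
have step s : (0 < s)%N ->
    l1 (phi s v) <= (delta * lmax * b * k ^+ s + l1 (phi s.+1 v)) / a.
  move=> sp; rewrite ler_pdivlMr // mulrC -l1Z.
  rewrite zphi -phi_mulM; apply: le_trans (l1_phi_mulM v sp) _.
  by rewrite lerD2r -/b mulrAC.
have lmax0 : 0 <= lmax.
  by have /rV0Pn[j _] := p0; apply: le_trans (normc_ge0 _) (dmax j).
set A := delta * lmax * b * (k / a).
have A0 : 0 <= A by rewrite /A mulr_ge0 // !mulr_ge0 ?(ltW b0).
(* Unrolling [m] times produces a geometric series of ratio [k / a <= 1 / 2], with partial sums at
   most [2 * (1 - 1 / 2 ^+ m)]. *)
have iter m : l1 (phi 1 v) <= 2 * A * (1 - 1 / 2 ^+ m) + l1 (phi m.+1 v) / a ^+ m.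
  elim: m => [|m IH]; first by rewrite !expr0 divr1 subrr mulr0 add0r divr1.
  apply: le_trans IH _.
  have := step m.+1 isT.
  have am : 0 <= (a ^+ m)^-1 by rewrite invr_ge0 exprn_ge0 // ltW.
  move=> /(ler_wpM2r am).
  have -> : (delta * lmax * b * k ^+ m.+1 + l1 (phi m.+2 v)) / a / a ^+ m =
      A * (k / a) ^+ m + l1 (phi m.+2 v) / a ^+ m.+1.
    rewrite /A expr_div_n !exprS; field.
    by rewrite expf_neq0 ?gt_eqF.
  have := ler_wpM2l A0 (kXa m).
  have -> : 1 / 2 ^+ m.+1 = (1 / 2 ^+ m) / 2 :> R.
    by rewrite exprS; field; rewrite expf_neq0.
  set u := (k / a) ^+ m; set w := 1 / 2 ^+ m.
  set x1 := _ / a ^+ m; set x2 := _ / a ^+ m.+1 => h1 h2.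
  have -> : 2 * A * (1 - w / 2) = 2 * A * (1 - w) + A * w by field.
  lra.
have key : l1 (phi 1 v) <= 2 * A.
  apply: (@le_add_pow2 _ _ _ (C * k) s0) => m hm.
  apply: le_trans (iter m) _; apply: lerD.
    rewrite -[leRHS]mulr1; apply: ler_wpM2l; first by rewrite mulr_ge0.
    by rewrite gerBl divr_ge0 // exprn_ge0.
  have C0 : 0 <= C.
    by have := le_trans (l1_ge0 _) (tail1 m hm); rewrite pmulr_lge0 ?exprn_gt0.
  have := tail2 m.+1 (leqW hm); rewrite -/(phi _ _).
  have am : 0 <= (a ^+ m)^-1 by rewrite invr_ge0 exprn_ge0 // ltW.
  move=> /(ler_wpM2r am) /le_trans; apply.
  have -> : C * k ^+ m.+1 / a ^+ m = C * k * (k / a) ^+ m.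
    by rewrite exprS expr_div_n; ring.
  apply: ler_wpM2l; first by rewrite mulr_ge0 // ltW.
  by rewrite -[leRHS]mul1r.
apply: contrapT => /forallNP far.
have {}far j : 2 * delta * lmax * k / a < normc (z - d 0 j).
  by rewrite ltNge; apply/negP/far.
(* The eigenvalue equation at [s = 0] multiplies the [j]-th entry of [phi 0 v] by [z - d 0 j]; were
   all these factors above the claimed bound, [phi 1 v] would exceed what [key] allows. *)
have e1 : phi 1 v = phi 0 v *m diag_mx (\row_j (z - d 0 j)).
  have := zphi 0%N; rewrite expr0 mulmx1 WTW mulmx1 => /eqP.
  rewrite addrC -subr_eq => /eqP <-.
  apply/rowP => j; rewrite !mul_mx_diag !mxE; ring.
have /rV0Pn[j0 hj0] := p0.
move: key; rewrite leNgt => /negP; apply.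
have -> : 2 * A = \sum_j (2 * delta * lmax * k / a) * normc (phi 0 v 0 j).
  rewrite -mulr_sumr -/(l1 _) -/b /A; ring.
rewrite /l1 (bigD1 j0) //= [ltRHS](bigD1 j0) //=; apply: ltr_leD.
  rewrite e1 mul_mx_diag !mxE Normc.normcM mulrC ltr_pM2l //.
  rewrite lt_def normc_ge0 andbT.
  by apply: contra hj0 => /eqP/Normc.eq0_normc; rewrite mxE => ->.
apply: ler_sum => j _.
by rewrite e1 mul_mx_diag !mxE Normc.normcM mulrC ler_wpM2l ?normc_ge0 // ltW.
Qed.

End Spiked.

(** * Power bounds for all exponents, and the deterministic eigenvalue bound *)

Lemma map_mxXn (R : rcfType) n (A : 'M[R]_n) s :
  map_mx (real_complex R) (A ^+ s) = (map_mx (real_complex R) A) ^+ s.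
Proof.
elim: s => [|s IH]; first by rewrite !expr0 map_mx1.
by rewrite !exprS -!mulmxE map_mxM IH.
Qed.

Lemma mulmx_entry_le (R : realDomainType) m n p (A : 'M[R]_(m, n))
    (B : 'M[R]_(n, p)) (a b : R) :
  (forall i j, `|A i j| <= a) -> (forall i j, `|B i j| <= b) ->
  forall i j, `|(A *m B) i j| <= n%:R * (a * b).
Proof.
move=> hA hB i j; rewrite mxE; apply: le_trans (ler_norm_sum _ _ _) _.
have -> : n%:R * (a * b) = \sum_(l < n) a * b.
  by rewrite sumr_const card_ord mulr_natl.
by apply: ler_sum => l _; rewrite normrM ler_pM.
Qed.

(** Splitting [s] as [s0 + (s - s0)] costs a factor [n] for the intermediate index, which the
    [1 / n] carried by the induction absorbs. That [1 / n] is bought once, on the window from [s0]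
    to [2 * s0], by [n <= Q ^+ s0]. *)
Lemma power_entry_le (R : realFieldType) n (A : 'M[R]_n) (K Q : R) (s0 : nat) :
  (0 < n)%N -> (0 < s0)%N -> 0 < K -> 1 <= Q -> n%:R <= Q ^+ s0 ->
  (forall s i j, (0 < s <= 2 * s0)%N -> `|(A ^+ s) i j| <= K ^+ s) ->
  forall s i j, (s0 <= s)%N -> `|(A ^+ s) i j| <= (Q * K) ^+ s / n%:R.
Proof.
move=> n0 s00 K0 Q1 nQ hA.
have n0R : 0 < n%:R :> R by rewrite ltr0n.
have Q0 : 0 < Q by apply: lt_le_trans Q1.
elim/ltn_ind => s IH i j hs.
have [small|big] := leqP s (2 * s0).
  rewrite ler_pdivlMr // exprMn mulrC.
  apply: ler_pM => //; last by apply: hA; rewrite small (leq_trans s00).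
  exact: le_trans nQ (ler_weXn2l Q1 hs).
have -> : s = (s0 + (s - s0))%N by rewrite subnKC.
rewrite exprD -mulmxE.
have h1 i' j' : `|(A ^+ s0) i' j'| <= (Q * K) ^+ s0 / n%:R.
  by apply: IH => //; lia.
have h2 i' j' : `|(A ^+ (s - s0)) i' j'| <= (Q * K) ^+ (s - s0) / n%:R.
  by apply: IH => //; lia.
apply: le_trans (mulmx_entry_le h1 h2 i j) _.
rewrite exprD le_eqVlt; apply/orP; left; apply/eqP; field.
by rewrite gt_eqF.
Qed.

(** Beyond the window, one factor [U] is bounded by 1 and the other by [V]; the two inner sums cost
    [n ^+ 2], of which [power_entry_le] regains one [n] and a second factor [Q ^+ s] pays for the
    other. *)
Lemma bilinear_power_le (R : realFieldType) n r (A : 'M[R]_n) (U : 'M[R]_(n, r))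
    (K Q V : R) (s0 : nat) :
  (0 < n)%N -> (0 < s0)%N -> 0 < K -> 1 <= Q -> n%:R <= Q ^+ s0 ->
  (forall i j, `|U i j| <= 1) -> (forall i j, `|U i j| <= V) ->
  (forall s i j, (0 < s <= 2 * s0)%N -> `|(A ^+ s) i j| <= K ^+ s) ->
  (forall s i j, (0 < s <= 2 * s0)%N ->
    `|(U^T *m A ^+ s *m U) i j| <= K ^+ s * V) ->
  forall s i j, (0 < s)%N ->
    `|(U^T *m A ^+ s *m U) i j| <= (Q ^+ 2 * K) ^+ s * V.
Proof.
move=> n0 s00 K0 Q1 nQ U1 UV hA hU s i j sp.
have n0R : 0 < n%:R :> R by rewrite ltr0n.
have Q0 : 0 < Q by apply: lt_le_trans Q1.
have V0 : 0 <= V.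
  by apply: le_trans (UV (Ordinal n0) j).
have [small|big] := leqP s (2 * s0).
  apply: le_trans (hU _ _ _ _) _; first by rewrite sp.
  apply: ler_wpM2r => //; rewrite exprMn ler_peMl ?exprn_ge0 ?(ltW K0) //.
  by rewrite !exprn_ege1.
have hs : (s0 <= s)%N by lia.
have h := power_entry_le n0 s00 K0 Q1 nQ hA.
have h1 i' j' : `|U^T i' j'| <= 1 by rewrite mxE.
have h2 := mulmx_entry_le h1 (fun i j => h s i j hs).
apply: le_trans (mulmx_entry_le h2 UV i j) _.
have -> : n%:R * (n%:R * (1 * ((Q * K) ^+ s / n%:R)) * V) =
    n%:R * (Q * K) ^+ s * V by field; rewrite gt_eqF.
apply: ler_wpM2r => //.
rewrite expr2 -mulrA [leRHS]exprMn; apply: ler_wpM2r.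
  by rewrite exprn_ge0 // mulr_ge0 // ltW.
exact: le_trans nQ (ler_weXn2l Q1 hs).
Qed.

Lemma orthonormal_entry_le1 (R : rcfType) n r (U : 'M[R]_(n, r)) :
  U^T *m U = 1%:M -> forall i j, `|U i j| <= 1.
Proof.
move=> hU i j; rewrite -(@ler_pXn2r _ 2) ?nnegrE // expr1n -normrX ger0_norm ?sqr_ge0 //.
have := congr1 (fun A : 'M[R]_r => A j j) hU; rewrite !mxE eqxx mulr1n => <-.
rewrite (bigD1 i) //= !mxE -expr2 lerDl sumr_ge0 // => l _.
by rewrite !mxE -expr2 sqr_ge0.
Qed.

Lemma sorted_norm_bounds (R : realDomainType) r (t : r.-tuple R) :
  sorted (fun x y => `|y| <= `|x|) t ->
  forall j, `|last 0 t| <= `|tnth t j| <= `|head 0 t|.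
Proof.
move=> st j.
have tr : transitive (fun x y : R => `|y| <= `|x|).
  by move=> x y w h1 h2; apply: le_trans h1.
have jr := ltn_ord j.
rewrite (tnth_nth 0) -nth_last -nth0.
have h := sorted_leq_nth tr (fun x => lexx `|x|) 0 st.
by apply/andP; split; apply: h; rewrite ?inE ?size_tuple //; lia.
Qed.

(** All probability is confined to the two bounds on powers in the window; the rest is
    deterministic, applied to the complexified matrices. *)
Lemma top_eigenvalue_near (R : realType) n r (A Hm : 'M[R]_n)
    (U : 'M[R]_(n, r)) (lam : r.-tuple R) (V K Q : R) (s0 : nat)
    (t : r.-tuple R[i]) (l : 'I_r) :
  let lmax := `|head 0 lam| in
  let lmin := `|last 0 lam| in
  let kappa := lmax / lmin in
  eigen_decomposition A U lam ->
  (forall i j, `|U i j| <= V) ->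
  (0 < n)%N -> (0 < s0)%N -> 0 < K -> 1 <= Q -> n%:R <= Q ^+ s0 ->
  (forall s i j, (0 < s <= 2 * s0)%N -> `|(Hm ^+ s) i j| <= K ^+ s) ->
  (forall s i j, (0 < s <= 2 * s0)%N ->
    `|(U^T *m Hm ^+ s *m U) i j| <= K ^+ s * V) ->
  16 * (Q ^+ 2 * K) * kappa <= lmin ->
  top_eigenvalues (A + Hm) t ->
  exists j : 'I_r, `|tnth t l - (tnth lam j)%:C| <=
    (32 * (Q ^+ 2 * K) * kappa * (r%:R * V))%:C.
Proof.
move=> lmax lmin kappa [UU AE lam0 lams] UV n0 s00 K0 Q1 nQ hA hU hk [s [cp st]].
have bnd := sorted_norm_bounds lams.
have r0 : (0 < r)%N := leq_ltn_trans (leq0n l) (ltn_ord l).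
have lmin0 : 0 < lmin.
  rewrite /lmin normr_gt0 -nth_last.
  have hr : (r.-1 < r)%N by rewrite ltn_predL.
  by have := lam0 (Ordinal hr); rewrite (tnth_nth 0) /= size_tuple.
have lmm : lmin <= lmax by have /andP[h1 h2] := bnd l; apply: le_trans h1 h2.
have kap1 : 1 <= kappa by rewrite ler_pdivlMr // mul1r.
set k := Q ^+ 2 * K in hk *.
have Q0 : 0 < Q by apply: lt_le_trans Q1.
have k0 : 0 < k by rewrite mulr_gt0 // exprn_gt0.
have V0 : 0 <= V by apply: le_trans (UV (Ordinal n0) l).
set delta := r%:R * V.
have delta0 : 0 <= delta by rewrite mulr_ge0.
pose f := map_mx (real_complex R).
pose HC := map_mx (real_complex R) Hm.
pose W := map_mx (real_complex R) U.
pose WT := map_mx (real_complex R) U^T.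
pose d : 'rV[R[i]]_r := map_mx (real_complex R) (\row_j tnth lam j).
have WTW : WT *m W = 1%:M by rewrite -map_mxM UU map_mx1.
have dmin j : lmin <= Normc.normc (d 0 j).
  by rewrite !mxE normc_real; have /andP[] := bnd j.
have dmax j : Normc.normc (d 0 j) <= lmax.
  by rewrite !mxE normc_real; have /andP[] := bnd j.
have WHW s' i j : (0 < s')%N ->
    Normc.normc ((WT *m HC ^+ s' *m W) i j) <= k ^+ s' * V.
  move=> sp; rewrite -map_mxXn -!map_mxM mxE normc_real.
  exact: (bilinear_power_le n0 s00 K0 Q1 nQ (orthonormal_entry_le1 UU)).
have ME : map_mx (real_complex R) (A + Hm) = W *m diag_mx d *m WT + HC.
  by rewrite map_mxD AE !map_mxM map_diag_mx.
rewrite ME in cp.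
set z := tnth t l.
have goalE j : (`|z - (tnth lam j)%:C| <= (32 * k * kappa * delta)%:C) =
    (Normc.normc (z - d 0 j) <= 32 * k * kappa * delta).
  by rewrite normrc lecR !mxE.
suff [j hj] : exists j, Normc.normc (z - d 0 j) <= 32 * k * kappa * delta.
  by exists j; rewrite goalE.
(* Above [lmin / 8] the localization applies, since [16 * k * kappa <= lmin] and [1 <= kappa] give
   [2 * k <= lmin / 8]. *)
have eig : lmin / 8 < Normc.normc z ->
    exists j, Normc.normc (z - d 0 j) <= 32 * k * kappa * delta.
  move=> hz.
  have rz : root (char_poly (W *m diag_mx d *m WT + HC)) z.
    rewrite cp root_prod_XsubC mem_cat.
    by rewrite mem_tnth.
  move: rz; rewrite -eigenvalue_root_char => /eigenvalueP[v vM v0].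
  have tail s' : (s0 <= s')%N -> l1 (v *m HC ^+ s') <= k ^+ s' * l1 v.
    move=> hs.
    have h i j : Normc.normc ((HC ^+ s') i j) <= (Q * K) ^+ s' / n%:R.
      rewrite -map_mxXn mxE normc_real.
      exact: (power_entry_le n0 s00 K0 Q1 nQ).
    apply: le_trans (l1_mulmx _ h) _; apply: ler_wpM2r; first exact: l1_ge0.
    rewrite mulrC divfK ?pnatr_eq0 -?lt0n // lerXn2r ?nnegrE ?mulr_ge0 ?(ltW K0)
      ?(ltW k0) ?(ltW Q0) //.
    by rewrite /k expr2 -mulrA ler_peMl // mulr_ge0 // ltW.
  have k2 : 2 * k <= Normc.normc z.
    have : k <= k * kappa by rewrite ler_peMr // ltW.
    by move: hk; rewrite -mulrA => ? ?; lra.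
  have [||j hj] := @eigenvalue_near R n r HC W WT d k V lmax WTW k0 V0 dmax WHW
     ((1 + r%:R) * l1 v) s0 z v _ _ vM v0 k2.
  - move=> s' hs; apply: le_trans (tail _ hs) _; rewrite mulrC ler_wpM2r //.
      by rewrite exprn_ge0 // ltW.
    by rewrite ler_peMl ?l1_ge0 // lerDl.
  - move=> s' hs.
    have h i j : Normc.normc (W i j) <= 1.
      by rewrite mxE normc_real (orthonormal_entry_le1 UU).
    apply: le_trans (l1_mulmx _ h) _; rewrite mulr1.
    apply: le_trans (ler_wpM2l _ (tail _ hs)) _ => //.
    rewrite mulrCA mulrC ler_wpM2r ?exprn_ge0 ?(ltW k0) //.
    by rewrite ler_wpM2r ?l1_ge0 // lerDr.
  exists j; apply: le_trans hj _.
  have z0 : 0 < Normc.normc z by apply: lt_trans hz; rewrite divr_gt0.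
  rewrite ler_pdivrMr //.
  have -> : 2 * (r%:R * V) * lmax * k = 2 * delta * k * kappa * lmin.
    by rewrite /kappa /delta; field; rewrite gt_eqF.
  have -> : 32 * k * kappa * delta * Normc.normc z =
            2 * delta * k * kappa * (16 * Normc.normc z) by ring.
  apply: ler_wpM2l; last lra.
  have kap0 := le_trans ler01 kap1.
  by apply: mulr_ge0 => //; apply: mulr_ge0 (ltW k0); apply: mulr_ge0.
(* In the first case the cone argument excludes small top eigenvalues; in the second the error bound
   exceeds [2 * lmin] and they do no harm. *)
have [big|small] := leP (16 * k * kappa * delta) lmin.
  apply: eig.
  pose m := Num.max 1 delta.
  have m1 : 1 <= m by rewrite le_max lexx.
  have md : delta <= m by rewrite le_max lexx orbT.
  have mm : 16 * k * kappa * m <= lmin.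
    by rewrite /m; case: (leP 1 delta) => _; rewrite ?mulr1.
  (* [tau * (lmin / 4)] equals [m * lmax * k], which dominates [delta * lmax * k], and
     [4 * tau <= lmin] is exactly [mm]. *)
  pose tau := 4 * kappa * k * m.
  have kk : k <= k * kappa by rewrite ler_peMr // ltW.
  have kk0 : 0 < k * kappa by apply: lt_le_trans kk.
  apply: (@top_eigenvalue_gt R n r HC W WT d k V lmin lmax WTW k0 V0 dmin dmax
     WHW tau _ t s l) => //.
  - rewrite /tau; have := ler_wpM2l (ltW kk0) m1; nra.
  - rewrite -/delta /tau; have := ler_wpM2r delta0 kk.
    have := ler_wpM2l (ltW kk0) md; have := mulr_ge0 (ltW kk0) delta0; nra.
  - rewrite -/delta /tau.
    have -> : 4 * kappa * k * m * (lmin / 4) = m * (lmax * k).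
      by rewrite /kappa; field; rewrite gt_eqF.
    rewrite -mulrA ler_wpM2r // mulr_ge0 ?(ltW k0) //.
    exact: le_trans (ltW lmin0) lmm.
  - by have -> : 4 * tau = 16 * k * kappa * m by rewrite /tau; ring.
  - by rewrite mulrC divfK.
have [zbig|zsmall] := ltP (lmin / 8) (Normc.normc z); first exact: eig.
(* An eigenvalue of modulus at most [lmin / 8] is within [9 * lmin / 8] of the last entry of [lam],
   whose modulus is [lmin]. *)
have hr : (r.-1 < r)%N by rewrite ltn_predL.
exists (Ordinal hr); apply: le_trans (normcB _ _) _.
have -> : Normc.normc (d 0 (Ordinal hr)) = lmin.
  by rewrite !mxE normc_real (tnth_nth 0) /= /lmin -nth_last size_tuple.
lra.
Qed.

(** * Counting walks *)

Section FirstOccurrence.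
Variables (K I : finType) (e : K -> I).

(** Encodes the partition of positions by equal values of [e] as an idempotent map to chosen
    representatives: the [pick] depends only on [e k], and its default is never reached because [k]
    itself qualifies. Fixed points correspond to distinct values. *)
Definition canonical_index : {ffun K -> K} :=
  [ffun k => odflt k [pick k' | e k' == e k]].

Definition covered_twice : bool :=
  [forall k, [exists k', (k' != k) && (e k' == e k)]].

Lemma canonical_indexE k : e (canonical_index k) = e k.
Proof. by rewrite ffunE; case: pickP => [k' /eqP|]. Qed.

Lemma eq_canonical_index k k' :
  (canonical_index k == canonical_index k') = (e k == e k').
Proof.
apply/eqP/eqP => [h|h]; first by rewrite -canonical_indexE h canonical_indexE.
rewrite !ffunE; under eq_pick do rewrite h.
by case: pickP => // /(_ k'); rewrite eqxx.
Qed.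

Lemma canonical_index_id k :
  canonical_index (canonical_index k) = canonical_index k.
Proof. by apply/eqP; rewrite eq_canonical_index canonical_indexE. Qed.

Lemma covered_twice_mate k : covered_twice ->
  exists2 k', k' != k & canonical_index k' = canonical_index k.
Proof.
move=> /forallP/(_ k)/existsP[k' /andP[h1 h2]]; exists k' => //.
by apply/eqP; rewrite eq_canonical_index.
Qed.

Lemma card_canonical_index :
  #|[set k | canonical_index k == k]| = #|[set e k | k in K]|.
Proof.
have -> : [set e k | k in K] = e @: [set k | canonical_index k == k].
  apply/setP => i; apply/imsetP/imsetP => -[k hk ->]; last by exists k.
  by exists (canonical_index k); rewrite ?canonical_indexE ?inE
    ?canonical_index_id.
rewrite card_in_imset // => k k'; rewrite !inE => /eqP hk /eqP hk' /eqP.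
by rewrite -eq_canonical_index hk hk' => /eqP.
Qed.

(** With [m i c] the [c]-th moment of entry [i], the product is the expectation of a word. An edge
    used once contributes a zero mean; otherwise each distinct edge contributes one [gam], and the
    powers of [beta] add up to the length of the word. *)
Lemma moment_word_le (R : realDomainType) (m : I -> nat -> R) (beta gam : R) :
  0 <= beta -> 0 <= gam ->
  (forall i, m i 0%N = 1) -> (forall i, m i 1%N = 0) ->
  (forall i c, (1 < c)%N -> `|m i c| <= gam * beta ^+ c) ->
  `|\prod_i m i #|[set k | e k == i]| | <=
    if covered_twice
    then beta ^+ #|K| * gam ^+ #|[set k | canonical_index k == k]| else 0.
Proof.
move=> b0 g0 m0 m1 m2; rewrite normr_prod.
case: ifPn => [good|/forallPn[k /existsPn hk]]; last first.
  rewrite (bigD1 (e k)) //= (_ : #|_| = 1%N) ?m1 ?normr0 ?mul0r //.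
  rewrite -(cards1 k); apply: eq_card => k'; rewrite !inE.
  have := hk k'; rewrite negb_and negbK => /orP[/eqP->|h]; first by rewrite !eqxx.
  by rewrite (negbTE h); apply/esym/negbTE; apply: contra h => /eqP->.
have hc i : #|[set k | e k == i]| != 1%N.
  apply/negP => /cards1P[k hk].
  have : k \in [set k | e k == i] by rewrite hk set11.
  rewrite inE => /eqP ek.
  have /forallP/(_ k)/existsP[k' /andP[n1 /eqP n2]] := good.
  have : k' \in [set k | e k == i] by rewrite inE n2 ek.
  by rewrite hk inE (negbTE n1).
apply: (@le_trans _ _ (\prod_i (beta ^+ #|[set k | e k == i]| *
    (if i \in [set e k | k in K] then gam else 1)))).
  apply: ler_prod => i _; rewrite normr_ge0 /=.
  move: (hc i); case E: #|_| => [|[|c]] // _.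
    rewrite m0 normr1 expr0 mul1r ifN //.
    apply/imsetP => -[k _ ik]; move/eqP: E; rewrite cards_eq0 => /eqP/setP/(_ k).
    by rewrite !inE ik eqxx.
  rewrite ifT; first by rewrite mulrC m2.
  have /card_gt0P[k] : (0 < #|[set k | e k == i]|)%N by rewrite E.
  by rewrite inE => /eqP <-; apply: imset_f.
rewrite big_split /= prodrXr -big_mkcond /= prodr_const card_canonical_index.
apply: ler_wpM2r; first by rewrite exprn_ge0.
rewrite (_ : \sum_i _ = #|K|)%N // -sum1_card (partition_big e xpredT) //=.
by apply: eq_bigr => i _; rewrite -sum1_card; apply: eq_bigl => k; rewrite inE.
Qed.

End FirstOccurrence.

(* A retraction pattern f is weighted by giving each fixed point the weight a;
   dropping the idempotency constraint turns the sum into a product. *)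
Lemma sum_fixed_points (R : realDomainType) (K : finType) (a : R) : 0 <= a ->
  \sum_(f : {ffun K -> K}) a ^+ #|[set k | f k == k]| <= (a + #|K|%:R) ^+ #|K|.
Proof.
move=> a0.
have -> : \sum_(f : {ffun K -> K}) a ^+ #|[set k | f k == k]| =
    \prod_(k : K) \sum_(j : K) (if j == k then a else 1).
  rewrite bigA_distr_bigA; apply: eq_bigr => f _.
  by rewrite -big_mkcond /= -prodr_const; apply: eq_bigl => k; rewrite inE.
rewrite -[leRHS]prodr_const; apply: ler_prod => k _; apply/andP; split.
  by apply: sumr_ge0 => j _; case: ifP.
rewrite (bigD1 k) //= eqxx lerD2l.
rewrite (eq_bigr (fun=> 1)) => [|j /negbTE -> //].
by rewrite sumr_const ler_nat max_card.
Qed.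

(** Within one pattern the power of [gam] is constant, so each pattern contributes [A] times
    [gam * c] to the number of its fixed points; [sum_fixed_points] then sums over all maps. *)
Lemma sum_by_pattern (R : realDomainType) (X K I : finType) (e : X -> K -> I)
    (w : X -> R) (c gam A : R) :
  (forall x, 0 <= w x) -> 0 <= c -> 0 <= gam -> 0 <= A ->
  (forall f, \sum_(x | covered_twice (e x) && (canonical_index (e x) == f)) w x
     <= A * c ^+ #|[set k | f k == k]|) ->
  \sum_(x | covered_twice (e x))
    w x * gam ^+ #|[set k | canonical_index (e x) k == k]| <=
  A * (gam * c + #|K|%:R) ^+ #|K|.
Proof.
move=> w0 c0 g0 A0 hf.
apply: le_trans (ler_wpM2l A0 (sum_fixed_points K (mulr_ge0 g0 c0))).
rewrite (partition_big (fun x => canonical_index (e x)) xpredT) //= mulr_sumr.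
apply: ler_sum => f _.
rewrite (eq_bigr (fun x => gam ^+ #|[set k | f k == k]| * w x)); last first.
  by move=> x /andP[_ /eqP ->]; rewrite mulrC.
rewrite -mulr_sumr exprMn mulrCA; apply: ler_wpM2l; first by rewrite exprn_ge0.
by rewrite mulrC [leRHS]mulrC mulrC; have := hf f; rewrite mulrC.
Qed.

(** Expanding the product of sums gives one nonnegative term per choice of coordinates on [D], and
    the left-hand terms appear among them without repetition. [j0] fills the coordinates outside
    [D]. *)
Lemma sum_determined (R : realDomainType) (X T J : finType) (v : X -> T -> J)
    (j0 : J) (P : pred X) (D : pred T) (w : T -> J -> R) :
  (forall t j, 0 <= w t j) ->
  (forall x y, P x -> P y -> (forall t, D t -> v x t = v y t) -> x = y) ->
  \sum_(x | P x) \prod_(t | D t) w t (v x t) <= \prod_(t | D t) \sum_j w t j.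
Proof.
move=> w0 inj.
pose h x : {ffun T -> J} := [ffun t => if D t then v x t else j0].
rewrite (big_distr_big j0).
have hinj : {in P &, injective h}.
  move=> x y Px Py /ffunP hxy; apply: inj => // t Dt.
  by have := hxy t; rewrite !ffunE Dt.
pose G (f : {ffun T -> J}) := \prod_(t | D t) w t (f t).
rewrite (eq_bigr (fun x => G (h x))); last first.
  by move=> x _; apply: eq_bigr => t Dt; rewrite ffunE Dt.
rewrite -(big_imset G hinj) /= [leRHS](bigID (mem [set h x | x in P])) /=.
rewrite -[leLHS]addr0; apply: lerD; last first.
  by apply: sumr_ge0 => f _; apply: prodr_ge0.
rewrite le_eqVlt; apply/orP; left; apply/eqP; apply: eq_bigl => f.
apply/idP/andP => [hf|[]//]; split=> //; case/imsetP: hf => x Px ->.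
apply/pffun_onP; split; last by move=> j _.
apply/fintype.subsetP => t; rewrite !inE ffunE.
by case: ifP => // _; rewrite eqxx.
Qed.

Section Walks.
Variables (R : realFieldType) (n p s : nat) (u : 'I_n -> R).
Hypothesis u_unit : \sum_i u i ^+ 2 <= 1.

(* p walks of s + 1 steps each; the position (a, t) is step t of walk a. *)
Definition walks := {ffun 'I_p -> {ffun 'I_s.+2 -> 'I_n}}.

Definition walk_edge (x : walks) (k : 'I_p * 'I_s.+1) : 'I_n * 'I_n :=
  (x k.1 (widen_ord (leqnSn _) k.2), x k.1 (lift ord0 k.2)).

Lemma walk_entry_le1 i : `|u i| <= 1.
Proof.
rewrite -(@ler_pXn2r _ 2) ?nnegrE // expr1n -normrX ger0_norm ?sqr_ge0 //.
apply: le_trans u_unit; rewrite (bigD1 i) //= lerDl sumr_ge0 // => j _.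
exact: sqr_ge0.
Qed.

Variable f : {ffun 'I_p * 'I_s.+1 -> 'I_p * 'I_s.+1}.
Let P (x : walks) :=
  covered_twice (walk_edge x) && (canonical_index (walk_edge x) == f).

(* Starts not recovered from the heads: the representatives of those edges
   that only occur as first steps. *)
Let rep (a : 'I_p) :=
  (f (a, ord0) == (a, ord0)) &&
  [forall k, (f k == (a, ord0)) ==> (k.2 == ord0)].

(** The positions that are free once the pattern is known: heads of representative edges, and the
    starts singled out by [rep]. *)
Let D (t : 'I_p * 'I_s.+2) :=
  if unlift ord0 t.2 is Some t' then f (t.1, t') == (t.1, t') else rep t.1.

Let w (t : 'I_p * 'I_s.+2) (i : 'I_n) : R :=
  if t.2 == ord0 then u i ^+ 2 else 1.

(** Every edge equals its representative, whose head is free, so all heads are determined. Only the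
    starts remain. *)
Lemma walks_determined (x y : walks) : P x -> P y ->
  (forall t, D t -> x t.1 t.2 = y t.1 t.2) -> x = y.
Proof.
move=> /andP[_ /eqP fx] /andP[_ /eqP fy] xy.
have ex (z : walks) (fz : canonical_index (walk_edge z) = f) k k' : f k = f k' ->
    walk_edge z k = walk_edge z k'.
  by rewrite -fz => /eqP; rewrite eq_canonical_index => /eqP.
have fid k : f (f k) = f k by rewrite -fx canonical_index_id.
have heads a t : x a (lift ord0 t) = y a (lift ord0 t).
  have := ex _ fx _ _ (esym (fid (a, t))); have := ex _ fy _ _ (esym (fid (a, t))).
  case E: (f (a, t)) => [a' t'] [_ /= ->] [_ /= ->].
  by apply: (xy (a', lift ord0 t')); rewrite /D /= liftK -E fid.
apply/ffunP => a; apply/ffunP => t.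
case: (unliftP ord0 t) => [t' ->|->]; first exact: heads.
have start (z : walks) : z a ord0 = (walk_edge z (a, ord0)).1.
  by rewrite /walk_edge /=; congr (z a _); apply: val_inj.
(* Either the edge occurs only as a first step, and its start is that of a representative in [rep];
   or it also occurs as a later step, whose tail is the head of the preceding step. *)
case/boolP: [forall k, (f k == f (a, ord0)) ==> (k.2 == ord0)] => [pure|].
  have fa2 : (f (a, ord0)).2 = ord0.
    by apply/eqP; move/forallP/(_ (f (a, ord0)))/implyP: pure; apply; rewrite fid.
  have fa : f (a, ord0) = ((f (a, ord0)).1, ord0).
    by rewrite [LHS]surjective_pairing fa2.
  have st (z : walks) : canonical_index (walk_edge z) = f ->
      z a ord0 = z (f (a, ord0)).1 ord0.
    move=> fz; rewrite start -(ex z fz _ _ (fid (a, ord0))) fa /=.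
    by congr (z _ _); apply: val_inj.
  rewrite (st x fx) (st y fy).
  apply: (xy ((f (a, ord0)).1, ord0)); rewrite /D /= unlift_none /rep -fa fid eqxx.
  exact: pure.
case/forallPn => -[a' t']; rewrite negb_imply /= => /andP[/eqP fk t'0].
rewrite !start -(ex _ fx _ _ fk) -(ex _ fy _ _ fk) /=.
case: (unliftP ord0 t') => [t'' t'E|t'E]; last by rewrite t'E eqxx in t'0.
have -> : widen_ord (leqnSn s.+1) t' = lift ord0 (widen_ord (leqnSn s) t'').
  by apply: val_inj; rewrite t'E.
exact: heads.
Qed.

(** Walks are grouped by the walk holding the representative of their first edge. A group with
    [rep b] contains two distinct walks with the same start, giving [u i ^+ 2]; all other factors
    are at most 1. *)
Lemma walk_starts_le (x : walks) : P x ->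
  \prod_a `|u (x a ord0)| <= \prod_(t | D t) w t (x t.1 t.2).
Proof.
move=> /andP[good /eqP fx].
have -> : \prod_(t | D t) w t (x t.1 t.2) = \prod_(a | rep a) u (x a ord0) ^+ 2.
  rewrite (bigID (fun t : 'I_p * 'I_s.+2 => t.2 == ord0)) /= [X in _ * X]big1 ?mulr1.
    rewrite (reindex_onto (fun a => (a, ord0)) fst) /=; last first.
      by move=> [a t] /andP[_ /eqP /= ->].
    apply: eq_big => [a|a _]; last by rewrite /w eqxx.
    by rewrite /D /= unlift_none !eqxx !andbT.
  by move=> t /andP[_ /negbTE h]; rewrite /w h.
rewrite (partition_big (fun a => (f (a, ord0)).1) xpredT) //= [leRHS]big_mkcond /=.
apply: ler_prod => b _; rewrite prodr_ge0 //=.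
have le1 (Q : pred 'I_p) : \prod_(a | Q a) `|u (x a ord0)| <= 1.
  by apply: prodr_ile1 => a _; rewrite normr_ge0 walk_entry_le1.
case: ifP => [/andP[/eqP fb /forallP pure]|_]; last exact: le1.
(* The second occurrence of the first edge of [b] is again a first step by [pure], hence belongs to
   another walk [m]. *)
have [[m t] km] := covered_twice_mate (b, ord0) good; rewrite fx fb => fm.
have := pure (m, t); rewrite fm eqxx /= => /eqP t0; subst t.
have mb : m != b by apply: contra km => /eqP ->.
have xm : x m ord0 = x b ord0.
  have : walk_edge x (m, ord0) = walk_edge x (b, ord0).
    by apply/eqP; rewrite -eq_canonical_index fx fm fb.
  move=> [+ _]; rewrite /=.
  by rewrite (_ : widen_ord _ _ = ord0) //; apply: val_inj.
rewrite (bigD1 b) /=; last by rewrite fb.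
rewrite (bigD1 m) /=; last by rewrite fm eqxx.
rewrite xm mulrA -expr2 -normrX ger0_norm ?sqr_ge0 // ler_piMr ?sqr_ge0 //.
Qed.

(** Summed freely, a start costs at most 1 by [u_unit] and a head costs [n]; the heads in [D] are in
    bijection with the fixed points of [f]. *)
Lemma walk_class_sum : (0 < n)%N ->
  \sum_(x | P x) \prod_a `|u (x a ord0)| <= n%:R ^+ #|[set k | f k == k]|.
Proof.
move=> n0.
apply: le_trans (ler_sum _ (fun x Px => walk_starts_le Px)) _.
have w0 t i : 0 <= w t i by rewrite /w; case: ifP => // _; rewrite sqr_ge0.
apply: le_trans
  (@sum_determined _ _ _ _ (fun (x : walks) t => x t.1 t.2) (Ordinal n0) P D w w0
     walks_determined) _.
rewrite (bigID (fun t : 'I_p * 'I_s.+2 => t.2 == ord0)) /= mulrC.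
apply: le_trans (ler_piMr _ _) _.
- by apply: prodr_ge0 => t _; apply: sumr_ge0.
- apply: prodr_ile1 => t /andP[_ t0].
  rewrite (eq_bigr (fun i => u i ^+ 2)) => [|i _]; last by rewrite /w t0.
  by rewrite u_unit andbT; apply: sumr_ge0 => i _; apply: sqr_ge0.
rewrite (eq_bigr (fun=> n%:R)); last first.
  move=> t /andP[_ /negbTE t0]; rewrite (eq_bigr (fun=> 1)).
    by rewrite sumr_const card_ord.
  by move=> i _; rewrite /w t0.
rewrite prodr_const le_eqVlt; apply/orP; left; apply/eqP; congr (_ ^+ _).
rewrite -(card_imset _ (_ : injective (fun k : 'I_p * 'I_s.+1 => (k.1, lift ord0 k.2)))).
  apply: eq_card => -[a t]; rewrite -topredE /= /D /=.
  apply/andP/imsetP => [[]|[[a' t'] + [-> ->]]].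
    case: unliftP => [t' -> fk _|->]; last by rewrite eqxx.
    by exists (a, t'); rewrite ?inE.
  by rewrite inE liftK.
by move=> [a t] [a' t'] /= [-> tt']; congr (_, _); apply: val_inj.
Qed.

End Walks.

Lemma sum_ffun_cons (R : nmodType) (T : finType) m
    (F : {ffun 'I_m.+1 -> T} -> R) :
  \sum_y F y = \sum_i \sum_(y : {ffun 'I_m -> T})
    F [ffun t => if unlift ord0 t is Some t' then y t' else i].
Proof.
rewrite pair_big /= (reindex (fun q : T * {ffun 'I_m -> T} =>
  [ffun t => if unlift ord0 t is Some t' then q.2 t' else q.1])) //=.
exists (fun y => (y ord0, [ffun t => y (lift ord0 t)])) => [[i y] _|y _] /=.
  rewrite ffunE unlift_none; congr (_, _); apply/ffunP => t.
  by rewrite !ffunE liftK.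
apply/ffunP => t; rewrite ffunE; case: unliftP => [t' ->|-> //].
by rewrite ffunE.
Qed.

(** The left vector [a] is general so that the induction can absorb the first step into it. *)
Lemma power_walk_sum (R : comPzRingType) n (A : 'M[R]_n) (v a : 'I_n -> R) s :
  \sum_i \sum_j a i * (A ^+ s) i j * v j =
  \sum_(y : {ffun 'I_s.+1 -> 'I_n}) a (y ord0) *
    (\prod_(t < s) A (y (widen_ord (leqnSn _) t)) (y (lift ord0 t))) *
    v (y ord_max).
Proof.
elim: s a => [|s IH] a.
  rewrite sum_ffun_cons; apply: eq_bigr => i _.
  rewrite expr0 (bigD1 i) //= big1 => [|j ji]; last first.
    by rewrite mxE eq_sym (negbTE ji) mulr0 mul0r.
  rewrite mxE eqxx mulr1 addr0.
  have e0 (y : {ffun 'I_0 -> 'I_n}) : y = [ffun=> i] by apply/ffunP => -[].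
  rewrite (big_pred1 [ffun=> i]) => [|y]; last by rewrite /= [y]e0 eqxx.
  by rewrite big_ord0 !ffunE unlift_none (_ : ord_max = ord0) ?unlift_none ?mulr1
    ?addr0 //; apply: val_inj.
rewrite sum_ffun_cons [RHS]exchange_big /=.
transitivity (\sum_k \sum_j (\sum_i a i * A i k) * (A ^+ s) k j * v j).
  rewrite exchange_big /= [RHS]exchange_big /=; apply: eq_bigr => j _.
  under eq_bigr => i _ do rewrite exprS -mulmxE mxE mulr_sumr mulr_suml.
  rewrite exchange_big /=; apply: eq_bigr => k _.
  by rewrite !mulr_suml; apply: eq_bigr => i _; rewrite !mulrA.
rewrite (IH (fun k => \sum_i a i * A i k)); apply: eq_bigr => y _.
rewrite !mulr_suml; apply: eq_bigr => i _.
rewrite big_ord_recl !ffunE.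
have -> : widen_ord (leqnSn s.+1) ord0 = ord0 by apply: val_inj.
have -> : ord_max = lift ord0 (@ord_max s) by apply: val_inj.
rewrite unlift_none !liftK !mulrA; congr (_ * _ * _).
apply: eq_bigr => t _; rewrite !ffunE.
have -> : widen_ord (leqnSn s.+1) (lift ord0 t) =
  lift ord0 (widen_ord (leqnSn s) t) by apply: val_inj.
by rewrite !liftK.
Qed.

Local Open Scope classical_set_scope.
Local Open Scope ring_scope.
Local Open Scope complex_scope.

(** * Expectations of bounded random variables *)

Section BoundedExpectation.
Context d (Omega : measurableType d) (R : realType) (P : probability Omega R).
Implicit Types f g Y : Omega -> R.

(** A class closed under the sums and products of the moment expansion, in which integrability is
    automatic. *)
Definition bounded_measurable f :=
  measurable_fun setT f /\ exists K, forall w, `|f w| <= K.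

Definition Ex f : R := \int[P]_w f w.

Lemma bm_cst c : bounded_measurable (fun=> c).
Proof. by split; [exact: measurable_cst|exists `|c|]. Qed.

Lemma bmD f g : bounded_measurable f -> bounded_measurable g ->
  bounded_measurable (fun w => f w + g w).
Proof.
move=> [mf [K hf]] [mg [L hg]]; split; first exact: measurable_funD.
by exists (K + L) => w; apply: le_trans (ler_normD _ _) (lerD (hf w) (hg w)).
Qed.

Lemma bmM f g : bounded_measurable f -> bounded_measurable g ->
  bounded_measurable (fun w => f w * g w).
Proof.
move=> [mf [K hf]] [mg [L hg]]; split; first exact: measurable_funM.
by exists (K * L) => w; rewrite normrM ler_pM.
Qed.

Lemma bmZ c f : bounded_measurable f -> bounded_measurable (fun w => c * f w).
Proof. exact: bmM (bm_cst c). Qed.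

Lemma bm_sum (I : finType) (F : I -> Omega -> R) (Q : pred I) :
  (forall i, bounded_measurable (F i)) ->
  bounded_measurable (fun w => \sum_(i | Q i) F i w).
Proof.
move=> hF; elim: (index_enum I) => [|i s IH].
  by under [X in bounded_measurable X]eq_fun do rewrite big_nil; apply: bm_cst.
under [X in bounded_measurable X]eq_fun do rewrite big_cons.
by case: (Q i) => //; apply: bmD.
Qed.

Lemma bm_prod (I : finType) (F : I -> Omega -> R) (Q : pred I) :
  (forall i, bounded_measurable (F i)) ->
  bounded_measurable (fun w => \prod_(i | Q i) F i w).
Proof.
move=> hF; elim: (index_enum I) => [|i s IH].
  by under [X in bounded_measurable X]eq_fun do rewrite big_nil; apply: bm_cst.
under [X in bounded_measurable X]eq_fun do rewrite big_cons.
by case: (Q i) => //; apply: bmM.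
Qed.

Lemma bmX f n : bounded_measurable f -> bounded_measurable (fun w => f w ^+ n).
Proof.
move=> hf; elim: n => [|n IH].
  by under [X in bounded_measurable X]eq_fun do rewrite expr0; apply: bm_cst.
by under [X in bounded_measurable X]eq_fun do rewrite exprS; apply: bmM.
Qed.

Lemma bm_indic A : measurable A -> bounded_measurable (\1_A : Omega -> R).
Proof.
move=> mA; split; first exact: measurable_indic.
by exists 1 => w; rewrite indicE; case: (_ \in _); rewrite ?normr1 ?normr0.
Qed.

Lemma bm_integrable f : bounded_measurable f -> P.-integrable setT (EFin \o f).
Proof.
move=> [mf [K hK]]; apply: measurable_bounded_integrable => //.
  by apply: le_lt_trans (probability_le1 P measurableT) _; rewrite ltry.
exists K; split; first exact: num_real.
by move=> x Kx w _ /=; apply: le_trans (hK w) (ltW Kx).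
Qed.

Lemma Ex_cst c : Ex (fun=> c) = c.
Proof.
rewrite /Ex Rintegral_cst // -[RHS]mulr1; congr (c * _).
exact: (congr1 fine (probability_setT P)).
Qed.

Lemma ExD f g : bounded_measurable f -> bounded_measurable g ->
  Ex (fun w => f w + g w) = Ex f + Ex g.
Proof. by move=> hf hg; rewrite /Ex RintegralD //; apply: bm_integrable. Qed.

Lemma ExZ c f : bounded_measurable f -> Ex (fun w => c * f w) = c * Ex f.
Proof. by move=> hf; rewrite /Ex RintegralZl //; apply: bm_integrable. Qed.

Lemma ExB f g : bounded_measurable f -> bounded_measurable g ->
  Ex (fun w => f w - g w) = Ex f - Ex g.
Proof. by move=> hf hg; rewrite /Ex RintegralB //; apply: bm_integrable. Qed.

Lemma bmB f g : bounded_measurable f -> bounded_measurable g ->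
  bounded_measurable (fun w => f w - g w).
Proof.
move=> [mf [K hf]] [mg [L hg]]; split; first exact: measurable_funB.
by exists (K + L) => w; apply: le_trans (ler_normB _ _) (lerD (hf w) (hg w)).
Qed.

Lemma eq_Ex f g : f =1 g -> Ex f = Ex g.
Proof. by move=> fg; apply: eq_Rintegral => w _. Qed.

Lemma Ex_sum (I : finType) (F : I -> Omega -> R) :
  (forall i, bounded_measurable (F i)) ->
  Ex (fun w => \sum_i F i w) = \sum_i Ex (F i).
Proof.
move=> hF.
suff [_ ->] : bounded_measurable (fun w => \sum_i F i w) /\
  Ex (fun w => \sum_i F i w) = \sum_i Ex (F i) by [].
elim: (index_enum I) => [|i s [bs IH]].
  split; last first.
    rewrite big_nil -[RHS](Ex_cst 0); apply: eq_Ex => w; exact: big_nil.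
  by under [X in bounded_measurable X]eq_fun do rewrite big_nil; apply: bm_cst.
under [X in bounded_measurable X]eq_fun do rewrite big_cons.
split; first exact: bmD.
rewrite big_cons -IH -ExD //; apply: eq_Ex => w; exact: big_cons.
Qed.

Lemma Ex_le f g : bounded_measurable f -> bounded_measurable g ->
  (forall w, f w <= g w) -> Ex f <= Ex g.
Proof. by move=> hf hg fg; apply: le_Rintegral => //; apply: bm_integrable. Qed.

Lemma bm_norm f : bounded_measurable f -> bounded_measurable (fun w => `|f w|).
Proof.
move=> [mf [K hK]]; split; first exact: measurableT_comp.
by exists K => w; rewrite normr_id.
Qed.

Lemma Ex_norm_le f g : bounded_measurable f -> bounded_measurable g ->
  (forall w, `|f w| <= g w) -> `|Ex f| <= Ex g.
Proof.
move=> hf hg fg; apply: le_trans (le_normr_Rintegral _ _) _ => //.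
  exact: bm_integrable.
exact: (Ex_le (bm_norm hf)).
Qed.

Lemma Ex_indic A : measurable A -> (Ex \1_A)%:E = P A.
Proof.
move=> mA; rewrite /Ex /Rintegral integral_indic // setIT fineK //.
exact: fin_num_measure.
Qed.

Lemma Ex_markov f (t : R) : bounded_measurable f -> (forall w, 0 <= f w) ->
  0 < t -> (P [set w | (t <= f w)%R] <= (Ex f / t)%:E)%E.
Proof.
move=> hf f0 t0.
have mA : measurable [set w | (t <= f w)%R].
  have := hf.1 measurableT _ (measurable_itv `[t, +oo[).
  rewrite setTI; congr (measurable _); apply/seteqP.
  by split=> w /=; rewrite in_itv /= andbT.
rewrite -Ex_indic // lee_fin ler_pdivlMr // mulrC -ExZ; last exact: bm_indic.
apply: Ex_le => // [|w]; first exact: (bmZ _ (bm_indic mA)).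
rewrite indicE; case: (boolP (_ \in _)) => [|_]; last by rewrite mulr0.
by rewrite inE /= mulr1.
Qed.

End BoundedExpectation.

(** * From indicators to bounded functions: product formula under independence *)

Section Layers.
Variable R : archiRealFieldType.

Lemma layer_sum_bounds (eps x : R) N : 0 < eps -> 0 <= x ->
  x <= N.+1%:R * eps ->
  x - eps <= \sum_(k < N) eps * (k.+1%:R * eps <= x)%R%:R <= x.
Proof.
move=> e0 x0; elim: N => [|N IH] hx.
  by rewrite big_ord0 x0 andbT subr_le0 -[eps]mul1r.
rewrite big_ord_recr /=; have [h|h] := leP (N.+1%:R * eps) x; last first.
  by rewrite mulr0 addr0; apply: IH; apply: ltW.
have -> : \sum_(k < N) eps * (k.+1%:R * eps <= x)%R%:R = N%:R * eps.
  rewrite (eq_bigr (fun=> eps)) => [|k _].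
    by rewrite sumr_const card_ord mulr_natl.
  have -> : k.+1%:R * eps <= x; last by rewrite mulr1.
  by apply: le_trans h; rewrite ler_wpM2r ?(ltW e0) // ler_nat ltnS ltnW.
have -> : N%:R * eps + eps * true%:R = N.+1%:R * eps.
  by rewrite mulr1 -natr1 mulrDl mul1r.
by rewrite h andbT lerBlDr -[X in _ + X]mul1r -mulrDl natr1.
Qed.

End Layers.

Section Transfer.
Context d (Omega : measurableType d) (R : realType) (P : probability Omega R).
Variables (H H' Y Y' : Omega -> R).
Hypotheses (mH : measurable_fun setT H) (mH' : measurable_fun setT H').
Hypotheses (bY : bounded_measurable Y) (bY' : bounded_measurable Y').
Hypothesis indicHY : forall A, measurable A ->
  Ex P (fun w => \1_A (H w) * Y w) = Ex P (fun w => \1_A (H' w) * Y' w).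

Lemma bm_comp (X : Omega -> R) (g : R -> R) (K : R) :
  measurable_fun setT X -> measurable_fun setT g -> (forall y, `|g y| <= K) ->
  bounded_measurable (fun w => g (X w)).
Proof.
move=> mX mg hg; split; last by exists K.
exact: measurableT_comp.
Qed.

(** The identity is linear in the function of [H], and a bounded nonnegative [g] is uniformly within
    [eps] of the finite combination [S] of indicators of its level sets. *)
Lemma Ex_transfer_ge0 (g : R -> R) (K : R) :
  measurable_fun setT g -> (forall y, 0 <= g y <= K) ->
  Ex P (fun w => g (H w) * Y w) = Ex P (fun w => g (H' w) * Y' w).
Proof.
move=> mg hg.
have K0 : 0 <= K by have /andP[h1 h2] := hg 0; apply: le_trans h1 h2.
have [mY [C hC]] := bY; have [mY' [C' hC']] := bY'.
have bg (X : Omega -> R) : measurable_fun setT X -> bounded_measurable (fun w => g (X w)).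
  move=> mX; apply: (@bm_comp X g K) => // y; have /andP[h1 h2] := hg y.
  by rewrite ger0_norm.
apply/eqP; rewrite -subr_eq0 -normr_eq0 eq_le normr_ge0 andbT.
have C0 : 0 <= C by apply: le_trans (hC point).
have C0' : 0 <= C' by apply: le_trans (hC' point).
apply/ler_addgt0Pr => e e0; rewrite add0r.
(* Replacing [g] by [S] costs at most [eps * C] on one side and [eps * C'] on the other; the [1]
   keeps the denominator positive. *)
set eps := e / (C + C' + 1).
have eps0 : 0 < eps by rewrite divr_gt0 // ltr_wpDl // addr_ge0.
set N := Num.bound (K / eps).
pose S y := \sum_(k < N) eps * \1_[set y | (k.+1%:R * eps <= g y)%R] y.
have mA (k : nat) : measurable [set y | (k.+1%:R * eps <= g y)%R].
  have := mg measurableT _ (measurable_itv `[k.+1%:R * eps, +oo[).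
  rewrite setTI; congr (measurable _); apply/seteqP.
  by split=> w /=; rewrite in_itv /= andbT.
have hS y : `|g y - S y| <= eps.
  have /andP[g0 gK] := hg y.
  have -> : S y = \sum_(k < N) eps * (k.+1%:R * eps <= g y)%R%:R.
    apply: eq_bigr => k _; congr (_ * _); rewrite indicE; congr ((nat_of_bool _)%:R).
    by apply/idP/idP; rewrite inE.
  have hN : g y <= N.+1%:R * eps.
    apply: le_trans gK _; rewrite -ler_pdivrMr //; apply: ltW.
    apply: lt_le_trans (archi_boundP _) _; first by rewrite divr_ge0 // ltW.
    by rewrite ler_nat.
  have /andP[h1 h2] := layer_sum_bounds eps0 g0 hN.
  by rewrite ger0_norm ?subr_ge0 // lerBlDl -lerBlDr.
have bS (X : Omega -> R) : measurable_fun setT X -> bounded_measurable (fun w => S (X w)).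
  move=> mX; apply: bm_sum => k; apply: bmZ.
  apply: (@bm_comp X (\1_[set y | (k.+1%:R * eps <= g y)%R]) 1 mX).
    exact: measurable_indic.
  by move=> y; rewrite indicE; case: (_ \in _); rewrite ?normr1 ?normr0.
have bI (X : Omega -> R) k : measurable_fun setT X -> bounded_measurable
    (fun w => \1_[set y | (k.+1%:R * eps <= g y)%R] (X w) : R).
  move=> mX; apply: (@bm_comp X (\1_[set y | (k.+1%:R * eps <= g y)%R]) 1 mX).
    exact: measurable_indic.
  by move=> y; rewrite indicE; case: (_ \in _); rewrite ?normr1 ?normr0.
have SE (X Z : Omega -> R) : measurable_fun setT X -> bounded_measurable Z ->
    Ex P (fun w => S (X w) * Z w) = \sum_(k < N) eps *
      Ex P (fun w => \1_[set y | (k.+1%:R * eps <= g y)%R] (X w) * Z w).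
  move=> mX bZ.
  rewrite (@eq_Ex _ _ _ _ _ (fun w => \sum_(k < N)
    eps * (\1_[set y | (k.+1%:R * eps <= g y)%R] (X w) * Z w))); last first.
    move=> w; rewrite mulr_suml; apply: eq_bigr => k _; exact: (esym (mulrA _ _ _)).
  rewrite Ex_sum; last by move=> k; apply/bmZ/bmM => //; apply: bI.
  by apply: eq_bigr => k _; rewrite ExZ //; apply: bmM => //; apply: bI.
have Seq : Ex P (fun w => S (H w) * Y w) = Ex P (fun w => S (H' w) * Y' w).
  by rewrite !SE //; apply: eq_bigr => k _; rewrite indicHY.
have diff (X Z : Omega -> R) c : measurable_fun setT X -> bounded_measurable Z -> 0 <= c ->
    (forall w, `|Z w| <= c) ->
    `|Ex P (fun w => g (X w) * Z w) - Ex P (fun w => S (X w) * Z w)| <= eps * c.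
  move=> mX bZ c0 hZ; have bgX := bg X mX; have bSX := bS X mX.
  rewrite -ExB; try exact: bmM.
  rewrite -[leRHS](Ex_cst P); apply: Ex_norm_le.
  - by apply: bmB; apply: bmM.
  - exact: bm_cst.
  - by move=> w; rewrite -mulrBl normrM ler_pM.
have h1 := diff H Y C mH bY C0 hC; have h2 := diff H' Y' C' mH' bY' C0' hC'.
rewrite Seq in h1.
apply: (@le_trans _ _ (eps * C + eps * C')).
  apply: le_trans (ler_distD (Ex P (fun w => S (H' w) * Y' w)) _ _) _.
  by apply: lerD => //; rewrite distrC.
rewrite -mulrDr /eps mulrAC ler_pdivrMr; last by rewrite ltr_wpDl // addr_ge0.
by apply: ler_wpM2l; [exact: ltW|rewrite lerDl].
Qed.

(** Adding [K] makes [g] nonnegative; the added term cancels because the indicator of the whole line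
    gives [Y] and [Y'] the same mean. *)
Lemma Ex_transfer (g : R -> R) (K : R) :
  measurable_fun setT g -> (forall y, `|g y| <= K) ->
  Ex P (fun w => g (H w) * Y w) = Ex P (fun w => g (H' w) * Y' w).
Proof.
move=> mg hg.
have bg (X : Omega -> R) : measurable_fun setT X -> bounded_measurable (fun w => g (X w)).
  by move=> mX; apply: (@bm_comp X g K).
have := @Ex_transfer_ge0 (fun y => g y + K) (K + K).
have h : forall y, 0 <= g y + K <= K + K.
  move=> y; have := hg y; rewrite ler_norml => /andP[h1 h2].
  by rewrite lerD2r h2 andbT -lerBlDr sub0r.
have mg' : measurable_fun setT (fun y => g y + K) by apply: measurable_funD.
move=> /(_ mg' h).
have split (X Z : Omega -> R) : measurable_fun setT X -> bounded_measurable Z ->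
    Ex P (fun w => (g (X w) + K) * Z w) =
    Ex P (fun w => g (X w) * Z w) + K * Ex P Z.
  move=> mX bZ; have bgX := bg X mX; rewrite -ExZ // -ExD; [|exact: bmM|exact: bmZ].
  by apply: eq_Ex => w; rewrite mulrDl.
have YY' : Ex P Y = Ex P Y'.
  have := indicHY measurableT.
  have triv (X Z : Omega -> R) : Ex P (fun w => \1_setT (X w) * Z w) = Ex P Z.
    by apply: eq_Ex => w; rewrite indicT mul1r.
  by rewrite !triv.
by rewrite !split // YY' => /addIr.
Qed.

End Transfer.

Section Independence.
Context d (Omega : measurableType d) (R : realType) (P : probability Omega R).
Variables (I : finType) (X : I -> {RV P >-> R}).
Hypothesis indep : mutually_independent X.

Lemma Ex_prod_indicator (A : I -> set R) : (forall i, measurable (A i)) ->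
  Ex P (fun w => \prod_i \1_(A i) (X i w)) =
  \prod_i Ex P (fun w => \1_(A i) (X i w)).
Proof.
move=> mA.
have mX i : measurable (X i @^-1` A i).
  have mX : measurable_fun setT (X i) by [].
  by have := mX measurableT _ (mA i); rewrite setTI.
have E1 i : (Ex P (fun w => \1_(A i) (X i w)))%:E = P (X i @^-1` A i).
  rewrite -Ex_indic //; congr (_%:E); apply: eq_Ex => w.
apply: EFin_inj; rewrite -prodEFin (eq_bigr _ (fun i _ => E1 i)).
have -> : (\prod_i P (X i @^-1` A i) =
           \prod_(i in finset.setTfor I) P (X i @^-1` A i))%E.
  by apply: eq_bigl => i; rewrite finset.in_setT.
rewrite -(indep _ mA) -Ex_indic; last first.
  by apply: fin_bigcap_measurable => // i _.
congr (_%:E); apply: eq_Ex => w; rewrite indicE.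
case: (boolP (w \in _)) => [|].
  rewrite inE => hw; rewrite big1 // => i _; rewrite indicE.
  by rewrite mem_set //; apply: hw; rewrite /= finset.in_setT.
rewrite notin_setE => hN.
have [i hw] : exists i, ~ A i (X i w).
  apply: contrapT => h; apply: hN => i _; apply: contrapT => h2.
  by apply: h; exists i.
rewrite (bigD1 i) //= indicE memNset ?mul0r //.
Qed.

Lemma Ex_prod_indep (g : I -> R -> R) (K : R) :
  (forall i, measurable_fun setT (g i)) -> (forall i y, `|g i y| <= K) ->
  Ex P (fun w => \prod_i g i (X i w)) = \prod_i Ex P (fun w => g i (X i w)).
Proof.
move=> mg hg.
(* The factors are replaced by indicators one at a time; S collects those
   that have not been replaced yet. *)
have main m : forall (S : {set I}) (h : I -> R -> R) (L : R), (#|S| <= m)%N ->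
    (forall i, measurable_fun setT (h i)) -> (forall i y, `|h i y| <= L) ->
    (forall i, i \notin S -> exists2 A, measurable A & h i = \1_A) ->
    Ex P (fun w => \prod_i h i (X i w)) = \prod_i Ex P (fun w => h i (X i w)).
  elim: m => [|m IH] S h L Sm mh bh hS.
    have S0 i : i \notin S.
      by move: Sm; rewrite leqn0 finset.cards_eq0 => /eqP ->; rewrite finset.in_set0.
    have [A hA] := choice (fun i => let: ex_intro2 A mA e := hS i (S0 i) in
      ex_intro (fun A => measurable A /\ h i = \1_A) A (conj mA e)).
    have eh : h = fun i => \1_(A i) by apply: funext => i; case: (hA i).
    by rewrite eh; apply: Ex_prod_indicator => i; case: (hA i).
  have bX i : bounded_measurable (fun w => h i (X i w)).
    by apply: (@bm_comp _ Omega R (X i) (h i) L).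
  case: (pickP (mem S)) => [i iS|S0]; last first.
    apply: (IH finset.set0 h L) => //; first by rewrite finset.cards0.
    by move=> i _; apply: hS; rewrite -[_ \in _]/(mem S i) S0.
  have {}iS : i \in S := iS.
  pose Y w := \prod_(j | j != i) h j (X j w).
  pose c := \prod_(j | j != i) Ex P (fun w => h j (X j w)).
  have bY : bounded_measurable Y by apply: bm_prod.
  have L0 : 0 <= L by apply: le_trans (bh i 0).
  transitivity (Ex P (fun w => h i (X i w) * Y w)).
    by apply: eq_Ex => w; rewrite (bigD1 i).
  rewrite (bigD1 i) //= -/c mulrC -ExZ //.
  transitivity (Ex P (fun w => h i (X i w) * c)); last first.
    by apply: eq_Ex => w; rewrite mulrC.
  (* Freezing the other factors as [Y], respectively as the constant [c], reduces the claim for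
     [h i] to indicators, where the induction hypothesis has one factor fewer to replace. *)
  apply: (@Ex_transfer _ _ _ P _ _ Y (fun=> c) _ _ _ _ _ (h i) L) => //.
    exact: bm_cst.
  move=> A mA.
  pose h' j := if j == i then \1_A else h j.
  have := IH (S :\ i)%SET h' (L + 1).
  have -> : Ex P (fun w => \prod_j h' j (X j w)) =
            Ex P (fun w => \1_A (X i w) * Y w).
    apply: eq_Ex => w; rewrite (bigD1 i) //= {1}/h' eqxx; congr (_ * _).
    by apply: eq_bigr => j /negbTE ji; rewrite /h' ji.
  have -> : \prod_j Ex P (fun w => h' j (X j w)) =
            Ex P (fun w => \1_A (X i w) * c).
    have -> : Ex P (fun w => \1_A (X i w) * c) =
              c * Ex P (fun w => \1_A (X i w)).
      rewrite -ExZ; first by apply: eq_Ex => w; rewrite mulrC.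
      apply: (@bm_comp _ Omega R (X i) \1_A 1) => //.
      by move=> y; rewrite indicE; case: (_ \in _); rewrite ?normr1 ?normr0.
    rewrite (bigD1 i) //= {1}/h' eqxx mulrC; congr (_ * _).
    by apply: eq_bigr => j /negbTE ji; rewrite /h' ji.
  apply.
  - by move: Sm; rewrite (finset.cardsD1 i) iS.
  - by move=> j; rewrite /h'; case: eqP => // _; apply: measurable_indic.
  - move=> j y; rewrite /h'; case: eqP => _.
      rewrite indicE; case: (_ \in _); rewrite ?normr1 ?normr0 ?addr_ge0 //.
      by rewrite lerDr.
    by apply: le_trans (bh j y) _; rewrite lerDl.
  - move=> j; rewrite finset.in_setD1 negb_and negbK /h'.
    by case: eqP => [_ _|_ /= jS]; [exists A|apply: hS].
by apply: (main #|I| (finset.setTfor I) g K) => // [|i];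
  rewrite ?max_card ?finset.in_setT.
Qed.

End Independence.

(** * Means and moments of truncated entries *)

Section Truncation.
Context d (Omega : measurableType d) (R : realType) (P : probability Omega R).
Variables (B : R) (B_gt0 : 0 < B).

Definition truncate (y : R) : R := if `|y| <= B then y else 0.

Lemma truncate_le y : `|truncate y| <= B.
Proof. by rewrite /truncate; case: ifP => // _; rewrite normr0 ltW. Qed.

Lemma truncate_norm_le y : `|truncate y| <= `|y|.
Proof. by rewrite /truncate; case: ifP => // _; rewrite normr0. Qed.

Lemma truncateN y : truncate (- y) = - truncate y.
Proof. by rewrite /truncate normrN; case: ifP => // _; rewrite oppr0. Qed.

Lemma measurable_truncate : measurable_fun setT truncate.
Proof.
have -> : truncate = fun y => y * \1_[set` `[- B, B]] y.
  apply: funext => y; rewrite /truncate indicE mem_setE in_itv /= -ler_norml.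
  by case: ifP => _; rewrite ?mulr1 ?mulr0.
by apply: measurable_funM; [exact: measurable_id|exact: measurable_indic].
Qed.

Variable X : {RV P >-> R}.

Lemma bm_truncate : bounded_measurable (fun w => truncate (X w)).
Proof.
apply: (@bm_comp _ Omega R X truncate B) => //; first exact: measurable_truncate.
exact: truncate_le.
Qed.

(** Truncation is odd, so symmetry makes its mean equal to its own negative. *)
Lemma Ex_truncate_sym : symmetric_distribution X ->
  Ex P (fun w => truncate (X w)) = 0.
Proof.
move=> sX.
have mX : measurable_fun setT X by [].
have mN : measurable_fun setT (fun w => - X w) by apply: measurable_funN.
have h : Ex P (fun w => truncate (X w) * 1) =
         Ex P (fun w => truncate (- X w) * 1).
  apply: (@Ex_transfer _ _ _ P X (fun w => - X w) (fun=> 1) (fun=> 1)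
    mX mN _ _ _ truncate B); try exact: bm_cst.
  - move=> A mA; apply: EFin_inj.
    have e (Z : Omega -> R) : measurable_fun setT Z ->
        (Ex P (fun w => \1_A (Z w) * 1))%:E = P [set w | A (Z w)].
      move=> mZ; rewrite -Ex_indic.
        congr (_%:E); apply: eq_Ex => w; rewrite mulr1 !indicE.
        by congr ((nat_of_bool _)%:R); apply/idP/idP; rewrite !inE.
      by have := mZ measurableT _ mA; rewrite setTI.
    by rewrite !e // -sX.
  - exact: measurable_truncate.
  - exact: truncate_le.
have bt := bm_truncate.
have e1 : Ex P (fun w => truncate (X w)) = - Ex P (fun w => truncate (X w)).
  rewrite -[RHS]mulN1r -ExZ //.
  transitivity (Ex P (fun w => truncate (X w) * 1)).
    by apply: eq_Ex => w; rewrite mulr1.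
  by rewrite h; apply: eq_Ex => w; rewrite mulr1 truncateN mulN1r.
lra.
Qed.

Lemma Ex_truncate_ae : {ae P, forall w, `|X w| <= B} -> ('E_P[X] = 0)%E ->
  Ex P (fun w => truncate (X w)) = 0.
Proof.
move=> aeB EX; rewrite unlock in EX.
rewrite /Ex /Rintegral (_ : \int[P]_w _ = 0)%E // -EX.
apply: ae_eq_integral => //.
- by apply/measurable_EFinP; case: bm_truncate.
- exact/measurable_EFinP.
by apply: filterS aeB => w hw _; rewrite /truncate hw.
Qed.

Lemma Ex_truncate_sqr (sigma : R) : ('E_P[X] = 0)%E ->
  ('V_P[X] <= (sigma ^+ 2)%:E)%E ->
  Ex P (fun w => truncate (X w) ^+ 2) <= sigma ^+ 2.
Proof.
move=> EX; rewrite /variance unlock EX /= => hV.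
have b2 := bmX 2 bm_truncate.
rewrite -lee_fin; apply: le_trans hV; rewrite unlock /Ex /Rintegral fineK; last first.
  exact: integrable_fin_num (bm_integrable P b2).
apply: ge0_le_integral => //.
- by move=> w _; rewrite lee_fin sqr_ge0.
- by apply/measurable_EFinP; case: b2.
- by apply/measurable_EFinP; apply: measurable_funM; apply: measurable_funB.
move=> w _; rewrite lee_fin -[leRHS]/((X w - 0) * (X w - 0)) subr0 -expr2.
by rewrite -real_normK ?num_real // -[leRHS]real_normK ?num_real // lerXn2r ?nnegrE
  ?truncate_norm_le.
Qed.

Lemma Ex_truncate_moment (sigma : R) c : ('E_P[X] = 0)%E ->
  ('V_P[X] <= (sigma ^+ 2)%:E)%E -> (1 < c)%N ->
  `|Ex P (fun w => truncate (X w) ^+ c)| <= sigma ^+ 2 * B ^+ (c - 2).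
Proof.
move=> EX VX c1.
have b2 := bmX 2 bm_truncate.
apply: le_trans (ler_wpM2r (exprn_ge0 _ (ltW B_gt0)) (Ex_truncate_sqr EX VX)).
rewrite mulrC -ExZ //; apply: Ex_norm_le; [exact/bmX/bm_truncate|exact: bmZ|].
move=> w; rewrite -{1}(subnKC c1) exprD normrM mulrC [`|_ ^+ 2|]ger0_norm ?sqr_ge0 //.
rewrite ler_wpM2r ?sqr_ge0 // normrX lerXn2r ?nnegrE // ?truncate_le // ltW //.
Qed.

End Truncation.

(** * Moments of bilinear forms in powers of the noise *)

Definition bilinear (R : pzRingType) n (u : 'I_n -> R) (A : 'M[R]_n)
    (v : 'I_n -> R) : R := \sum_i \sum_j u i * A i j * v j.

Section BilinearMoments.
Context d (Omega : measurableType d) (R : realType) (P : probability Omega R).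
Variables (n : nat) (H : 'I_n -> 'I_n -> {RV P >-> R}) (B sigma : R).
Hypotheses (B_gt0 : 0 < B) (n_gt0 : (0 < n)%N).
Hypothesis indep : mutually_independent (fun ij : 'I_n * 'I_n => H ij.1 ij.2).

Definition truncated (w : Omega) : 'M[R]_n := \matrix_(i, j) truncate B (H i j w).

Hypothesis mean0 : forall i j, Ex P (fun w => truncated w i j) = 0.
Hypothesis moment_le : forall i j c, (1 < c)%N ->
  `|Ex P (fun w => truncated w i j ^+ c)| <= sigma ^+ 2 * B ^+ (c - 2).

Variables (u v : 'I_n -> R) (V : R).
Hypotheses (u_unit : \sum_i u i ^+ 2 <= 1) (v_le : forall i, `|v i| <= V).

Lemma bm_truncated i j : bounded_measurable (fun w => truncated w i j).
Proof.
have -> : (fun w => truncated w i j) = (fun w => truncate B (H i j w)).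
  by apply: funext => w; rewrite mxE.
exact: bm_truncate.
Qed.

Lemma bm_bilinear s :
  bounded_measurable (fun w => bilinear u (truncated w ^+ s) v).
Proof.
have -> : (fun w => bilinear u (truncated w ^+ s) v) = (fun w =>
    \sum_(y : {ffun 'I_s.+1 -> 'I_n}) (u (y ord0) * v (y ord_max)) *
    \prod_(t < s) truncated w (y (widen_ord (leqnSn _) t)) (y (lift ord0 t))).
  apply: funext => w; rewrite /bilinear power_walk_sum.
  by apply: eq_bigr => y _; rewrite mulrAC.
apply: bm_sum => y; apply: bmZ; apply: bm_prod => t; exact: bm_truncated.
Qed.

(** Equal edges are collected into powers of one entry, after which distinct entries are
    independent. *)
Lemma Ex_word (K : finType) (e : K -> 'I_n * 'I_n) :
  Ex P (fun w => \prod_k truncated w (e k).1 (e k).2) =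
  \prod_ij Ex P (fun w =>
    truncated w ij.1 ij.2 ^+ #|[set k | e k == ij]%SET|).
Proof.
pose c ij := #|[set k | e k == ij]%SET|.
pose g (ij : 'I_n * 'I_n) y := truncate B y ^+ c ij.
have mg ij : measurable_fun setT (g ij).
  apply: measurable_funX; exact: measurable_truncate.
have g1 ij y : `|g ij y| <= (1 + B) ^+ #|K|.
  rewrite normrX; have cK : (c ij <= #|K|)%N := max_card _.
  apply: (@le_trans _ _ ((1 + B) ^+ c ij)).
    rewrite lerXn2r ?nnegrE ?addr_ge0 ?(ltW B_gt0) //.
    by apply: le_trans (truncate_le B_gt0 _) _; rewrite lerDr.
  by apply: ler_weXn2l => //; rewrite lerDl ltW.
transitivity (Ex P (fun w => \prod_ij g ij (H ij.1 ij.2 w))).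
  apply: eq_Ex => w; rewrite (partition_big e xpredT) //=.
  apply: eq_bigr => ij _; rewrite /g /c -prodr_const.
  rewrite (eq_bigr (fun=> truncate B (H ij.1 ij.2 w))); last first.
    by move=> k /eqP ->; rewrite mxE.
  by apply: eq_bigl => k; rewrite finset.inE.
rewrite (Ex_prod_indep indep mg g1); apply: eq_bigr => ij _.
by apply: eq_Ex => w; rewrite /g mxE.
Qed.

(** The [p]-th power is a sum over [p] walks; coefficients are bounded through [walk_class_sum] and
    words through [moment_word_le]. *)
Lemma bilinear_moment_le p s D : (0 < p)%N -> (0 < s)%N ->
  0 < D -> (p * s)%:R * B <= D -> n%:R * (p * s)%:R * sigma ^+ 2 <= D ^+ 2 ->
  `|Ex P (fun w => bilinear u (truncated w ^+ s) v ^+ p)| <=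
  V ^+ p * (2 * D) ^+ (p * s).
Proof.
move=> p0; case: s => [//|s] _ D0 hB hs.
set q := (p * s.+1)%N in hB hs *.
have q0 : 0 < q%:R :> R by rewrite ltr0n muln_gt0 p0.
have n0 : 0 < n%:R :> R by rewrite ltr0n.
(* Chosen so that [B <= beta] and [sigma ^+ 2 <= gam * beta ^+ 2 = D ^+ 2 / (n * q)], whence [sigma
   ^+ 2 * B ^+ (c - 2) <= gam * beta ^+ c]. *)
set beta := D / q%:R; set gam := q%:R / n%:R : R.
have beta0 : 0 <= beta by rewrite divr_ge0 // ltW.
have gam0 : 0 <= gam by rewrite divr_ge0 // ltW.
have V0 : 0 <= V by apply: le_trans (v_le (Ordinal n_gt0)).
have cardK : #|{: 'I_p * 'I_s.+1}| = q by rewrite card_prod !card_ord.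
pose coef (x : walks n p s) := \prod_a (u (x a ord0) * v (x a ord_max)).
pose word (x : walks n p s) w :=
  \prod_k truncated w (walk_edge x k).1 (walk_edge x k).2.
have expand w : bilinear u (truncated w ^+ s.+1) v ^+ p =
    \sum_x coef x * word x w.
  rewrite /bilinear power_walk_sum -{1}[p]card_ord -prodr_const bigA_distr_bigA /=.
  apply: eq_bigr => x _; rewrite /coef /word.
  rewrite (eq_bigr (fun k => truncated w
    (x k.1 (widen_ord (leqnSn s.+1) k.2)) (x k.1 (lift ord0 k.2)))) //.
  rewrite -(pair_bigA _ (fun a t => truncated w
    (x a (widen_ord (leqnSn s.+1) t)) (x a (lift ord0 t)))) -big_split /=.
  by apply: eq_bigr => a _; rewrite mulrAC.
have bword x : bounded_measurable (word x).
  by apply: bm_prod => k; apply: bm_truncated.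
rewrite (eq_Ex _ expand) Ex_sum; last by move=> x; apply: bmZ.
have wordE x : `|Ex P (word x)| <=
    if covered_twice (walk_edge x)
    then beta ^+ q * gam ^+ #|[set k | canonical_index (walk_edge x) k == k]%SET|
    else 0.
  rewrite -cardK /word Ex_word.
  apply: (@moment_word_le _ _ (walk_edge x) R
    (fun ij c => Ex P (fun w => truncated w ij.1 ij.2 ^+ c))) => //.
  - by move=> ij; rewrite -[RHS](Ex_cst P); apply: eq_Ex => w; rewrite expr0.
  - by move=> ij; rewrite -[RHS](mean0 ij.1 ij.2); apply: eq_Ex => w; rewrite expr1.
  - move=> ij c c1; apply: le_trans (moment_le _ _ c1) _.
    rewrite -{2}(subnKC c1) exprD mulrA; apply: ler_pM.
    + exact: sqr_ge0.
    + by rewrite exprn_ge0 // ltW.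
    + rewrite /gam /beta.
      have -> : q%:R / n%:R * (D / q%:R) ^+ 2 = D ^+ 2 / (n%:R * q%:R).
        by field; rewrite !gt_eqF.
      by rewrite ler_pdivlMr ?mulr_gt0 // mulrC.
    + have hb : B <= beta by rewrite ler_pdivlMr // mulrC.
      by rewrite lerXn2r ?nnegrE // ltW.
have coefE x : `|coef x| <= V ^+ p * \prod_a `|u (x a ord0)|.
  have -> : V ^+ p = \prod_(a < p) V by rewrite prodr_const card_ord.
  rewrite /coef normr_prod -big_split /=.
  apply: ler_prod => a _; rewrite normr_ge0 normrM mulrC.
  by rewrite ler_wpM2r.
apply: le_trans (ler_norm_sum _ _ _) _.
apply: (@le_trans _ _ (\sum_(x | covered_twice (walk_edge x)) (V ^+ p * beta ^+ q) *
   ((\prod_a `|u (x a ord0)|) *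
     gam ^+ #|[set k | canonical_index (walk_edge x) k == k]%SET|))).
  rewrite [leRHS]big_mkcond /=; apply: ler_sum => x _.
  rewrite ExZ // normrM; have := wordE x; case: ifP => _ hw; last first.
    by rewrite (le_anti (_ : `|Ex P (word x)| <= 0 <= `|Ex P (word x)|)) ?mulr0
      // hw normr_ge0.
  rewrite mulrACA.
  exact: ler_pM.
rewrite -mulr_sumr.
(* [gam * n] equals [q], the number of positions, so the base is [beta * (q + q) = 2 * D]. *)
have -> : V ^+ p * (2 * D) ^+ q = V ^+ p * beta ^+ q *
    (1 * (gam * n%:R + #|{: 'I_p * 'I_s.+1}|%:R) ^+ #|{: 'I_p * 'I_s.+1}|).
  rewrite cardK mul1r -mulrA -exprMn; congr (_ * _ ^+ _).
  by rewrite /beta /gam; field; rewrite !gt_eqF.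
apply: ler_wpM2l; first by rewrite mulr_ge0 ?exprn_ge0.
apply: sum_by_pattern => // [x|f]; first exact: prodr_ge0.
by rewrite mul1r; apply: walk_class_sum.
Qed.

(** Markov's inequality for the even power [p]; all factors of the threshold except [T] cancel
    against the moment bound. *)
Lemma bilinear_tail p s D T : (0 < p)%N -> ~~ odd p -> (0 < s)%N ->
  0 < D -> (p * s)%:R * B <= D -> n%:R * (p * s)%:R * sigma ^+ 2 <= D ^+ 2 ->
  0 < V -> 0 < T ->
  (P [set w | ((2 * D * T) ^+ s * V <= `|bilinear u (truncated w ^+ s) v|)%R]
    <= (T ^- (p * s))%:E)%E.
Proof.
move=> p0 ep s0 D0 hB hs V0 T0.
set t := (2 * D * T) ^+ s * V.
have t0 : 0 < t by rewrite mulr_gt0 // exprn_gt0 // !mulr_gt0.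
have eX (x : R) : `|x| ^+ p = x ^+ p.
  by rewrite -normrX ger0_norm // exprn_even_ge0.
have -> : [set w | (t <= `|bilinear u (truncated w ^+ s) v|)%R] =
  [set w | (t ^+ p <= bilinear u (truncated w ^+ s) v ^+ p)%R].
  apply/seteqP; split=> w /=; rewrite -(eX (bilinear _ _ _));
    by rewrite ler_pXn2r // nnegrE ltW.
apply: le_trans (Ex_markov P (bmX p (bm_bilinear s)) _ (exprn_gt0 p t0)) _.
  by move=> w; rewrite exprn_even_ge0.
rewrite lee_fin ler_pdivrMr ?exprn_gt0 //.
apply: le_trans (ler_norm _) _.
apply: le_trans (bilinear_moment_le p0 s0 D0 hB hs) _.
have -> : t ^+ p = (2 * D) ^+ (p * s) * T ^+ (p * s) * V ^+ p.
  by rewrite /t exprMn -exprM mulnC (exprMn _ (2 * D)).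
have -> : T ^- (p * s) * ((2 * D) ^+ (p * s) * T ^+ (p * s) * V ^+ p) =
    V ^+ p * (2 * D) ^+ (p * s) * (T ^- (p * s) * T ^+ (p * s)) by ring.
by rewrite mulVf ?mulr1 // expf_neq0 // gt_eqF.
Qed.

End BilinearMoments.

(** * The high-probability event *)

Section UnionBound.
Context d (Omega : measurableType d) (R : realType) (P : probability Omega R).

Lemma measurable_norm_ge (f : Omega -> R) t : bounded_measurable f ->
  measurable [set w | (t <= `|f w|)%R].
Proof.
move=> /bm_norm[mf _].
have := mf measurableT _ (measurable_itv `[t, +oo[).
rewrite setTI; congr (measurable _); apply/seteqP.
by split=> w /=; rewrite in_itv /= andbT.
Qed.

Lemma union_bound (I : finType) (A : I -> set Omega) (c : I -> R) (S : R) :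
  (forall i, measurable (A i)) -> (forall i, (P (A i) <= (c i)%:E)%E) ->
  \sum_i c i <= S ->
  measurable [set w | forall i, ~ A i w] /\
  ((1 - S)%:E <= P [set w | forall i, ~ A i w])%E.
Proof.
move=> mA hA hS; set G := [set w | _].
have mG : measurable G.
  have -> : G = \bigcap_(i in [set: I]) ~` A i.
    by apply/seteqP; split=> w /= h i; [move=> _; apply: h|apply: h].
  by apply: fin_bigcap_measurable => // i _; apply: measurableC.
split=> //; rewrite -Ex_indic // lee_fin.
rewrite lerBlDr addrC -lerBlDr.
apply: le_trans hS.
have -> : 1 - Ex P \1_G = Ex P (fun w => 1 - \1_G w).
  by rewrite ExB ?Ex_cst //; [apply: bm_cst|apply: bm_indic].
apply: (@le_trans _ _ (Ex P (fun w => \sum_i \1_(A i) w))); last first.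
  rewrite Ex_sum; last by move=> i; apply: bm_indic.
  by apply: ler_sum => i _; rewrite -lee_fin Ex_indic.
apply: Ex_le.
- by apply: bmB; [apply: bm_cst|apply: bm_indic].
- by apply: bm_sum => i; apply: bm_indic.
move=> w; rewrite indicE; case: (boolP (w \in G)) => [_|].
  by rewrite subrr sumr_ge0.
rewrite notin_setE /G => hN.
have [i hi] : exists i, A i w.
  apply: contrapT => h; apply: hN => i hi; apply: h; by exists i.
rewrite subr0 (bigD1 i) //= indicE mem_set // lerDl sumr_ge0 //.
Qed.

End UnionBound.

Section GoodEvent.
Context d (Omega : measurableType d) (R : realType) (P : probability Omega R).
Variables (cb : R) (n r : nat) (sigma B : R).
Variables (H : 'I_n -> 'I_n -> {RV P >-> R}) (U : 'M[R]_(n, r)) (V : R).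
Hypotheses (n_gt1 : (1 < n)%N) (r_le_n : (r <= n)%N).
Hypotheses (sigma_ge0 : 0 <= sigma) (B_gt0 : 0 < B).
Hypothesis noise : noise_assumption cb sigma B H.
Hypotheses (UU : U^T *m U = 1%:M) (UV : forall i j, `|U i j| <= V).
Hypothesis V_gt0 : 0 < V.

Let N := noise_level n sigma B.
Let L : R := ln n%:R.
(** The constants fit [2 * s0 <= p s * s <= 6 * s0 <= 18 * L]: the upper end makes [D = 18 * N]
    admissible in the moment bound, and the lower end makes [T = expR 8] yield tails below
    [n%:R ^- 16]. *)
Let s0 := (Num.truncn L).+1.
Let T : R := expR 8.
Let D := 18 * N.

(** [1 / 2 <= L] comes from [1 - 1 / n <= ln n], and turns [s0 <= L + 1] into [s0 <= 3 * L]. *)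
Lemma ln_nat_bounds : [/\ 1 / 2 <= L, L <= s0%:R, s0%:R <= 3 * L & (s0 <= n)%N].
Proof.
have n0 : 0 < n%:R :> R by rewrite ltr0n (ltn_trans _ n_gt1).
have n2 : 2 <= n%:R :> R by rewrite ler_nat.
have L2 : 1 / 2 <= L.
  have e : expR (- L) = n%:R^-1 by rewrite expRN lnK ?posrE.
  have := expR_ge1Dx (- L); rewrite e.
  have : n%:R^-1 <= 2^-1 :> R by rewrite lef_pV2 ?posrE.
  lra.
have L0 : 0 <= L by apply: le_trans L2.
have /andP[h1 h2] := truncn_itv L0.
have Ln : L <= n%:R - 1.
  have := expR_ge1Dx L; rewrite lnK ?posrE //; lra.
have s1 : s0%:R = (Num.truncn L)%:R + 1 :> R by rewrite /s0 -natr1.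
split=> //; first exact: ltW.
- by rewrite s1; lra.
- by rewrite -(@ler_nat R) s1; lra.
Qed.

Lemma N_gt0 : 0 < N.
Proof.
have [L2 _ _ _] := ln_nat_bounds.
rewrite /N /noise_level lt_max; apply/orP; right.
by rewrite mulr_gt0 // (lt_le_trans _ L2).
Qed.

(** An even moment order for which [p s * s] is of order [s0] whatever the exponent [s] in the
    window. *)
Let p s := (2 * (s0 %/ s).+1)%N.

Lemma exponent_bounds s : (0 < s <= 2 * s0)%N ->
  (2 * s0 <= p s * s <= 6 * s0)%N.
Proof.
move=> /andP[s1 s2].
have h1 := ltn_ceil s0 s1; have h2 := leq_divM s0 s.
rewrite /p; apply/andP; split; nia.
Qed.

Lemma exponent_conditions s : (0 < s <= 2 * s0)%N ->
  [/\ (p s * s)%:R * B <= D, n%:R * (p s * s)%:R * sigma ^+ 2 <= D ^+ 2 &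
      T ^- (p s * s) <= n%:R ^- 16].
Proof.
move=> hs; have [L2 Ls s3 _] := ln_nat_bounds.
have /andP[q2 q6] := exponent_bounds hs.
have n0 : 0 < n%:R :> R by rewrite ltr0n (ltn_trans _ n_gt1).
have L0 : 0 <= L by apply: le_trans L2.
set q := (p s * s)%N in q2 q6 *.
have qL : q%:R <= 18 * L.
  apply: (@le_trans _ _ (6 * s0)%:R); first by rewrite ler_nat.
  by rewrite natrM; lra.
have NB : B * L <= N by rewrite /N /noise_level le_max lexx orbT.
have NS : sigma * Num.sqrt (n%:R * L) <= N by rewrite /N /noise_level le_max lexx.
split.
- have := ler_wpM2r (ltW B_gt0) qL; rewrite /D; lra.
- have h : n%:R * L * sigma ^+ 2 <= N ^+ 2.
    have nL : 0 <= n%:R * L by apply: mulr_ge0 L0; apply: ltW.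
    have -> : n%:R * L * sigma ^+ 2 = (sigma * Num.sqrt (n%:R * L)) ^+ 2.
      by rewrite exprMn (sqr_sqrtr nL) mulrC.
    have S0 : 0 <= sigma * Num.sqrt (n%:R * L) by rewrite mulr_ge0 ?sqrtr_ge0.
    rewrite lerXn2r // nnegrE //; exact: ltW N_gt0.
  have h2 : n%:R * q%:R * sigma ^+ 2 <= 18 * (n%:R * L * sigma ^+ 2).
    have -> : 18 * (n%:R * L * sigma ^+ 2) = n%:R * (18 * L) * sigma ^+ 2 by ring.
    by rewrite ler_wpM2r ?sqr_ge0 // ler_wpM2l // ltW.
  have N2 := sqr_ge0 N.
  by rewrite /D exprMn; lra.
- rewrite lef_pV2 ?posrE ?exprn_gt0 ?expR_gt0 //.
  have -> : n%:R ^+ 16 = expR (L * 16) by rewrite expRM_natr lnK.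
  rewrite /T -expRM_natr ler_expR.
  have : (2 * s0)%:R <= q%:R :> R by rewrite ler_nat.
  by rewrite natrM; lra.
Qed.

Lemma truncated_mean0 i j : Ex P (fun w => truncated H B w i j) = 0.
Proof.
have [_ EH _ bH] := noise.
transitivity (Ex P (fun w => truncate B (H i j w))).
  by apply: eq_Ex => w; rewrite mxE.
case: (bH i j) => [aeB|[sH _]]; first exact: Ex_truncate_ae.
exact: Ex_truncate_sym.
Qed.

Lemma truncated_moment i j c : (1 < c)%N ->
  `|Ex P (fun w => truncated H B w i j ^+ c)| <= sigma ^+ 2 * B ^+ (c - 2).
Proof.
have [_ EH VH _] := noise => c1.
rewrite (_ : Ex P _ = Ex P (fun w => truncate B (H i j w) ^+ c)).
  exact: Ex_truncate_moment.
by apply: eq_Ex => w; rewrite mxE.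
Qed.

Lemma noise_tail i j :
  (P [set w | (B < `|H i j w|)%R] <= (cb / n%:R ^+ 12)%:E)%E \/
  (P [set w | (B < `|H i j w|)%R] <= 0)%E.
Proof.
have [_ _ _ bH] := noise.
case: (bH i j) => [aeB|[_ h]]; [right|by left].
have mA : measurable [set w | (B < `|H i j w|)%R].
  have mH : measurable_fun setT (fun w => `|H i j w|) by apply: measurableT_comp.
  have := mH measurableT _ (measurable_itv `]B, +oo[).
  rewrite setTI; congr (measurable _); apply/seteqP.
  by split=> w /=; rewrite in_itv /= andbT.
case: aeB => Z [mZ PZ hZ].
apply: le_trans (_ : P Z <= 0)%E; last by rewrite PZ.
apply: le_measure; rewrite ?inE // => w /= Bw; apply: hZ => /=.
by rewrite leNgt Bw.
Qed.

Let K := 36 * T * N.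

(** A union bound over three families: entries altered by truncation, entries of the powers, and
    entries of their compressions by [U]. *)
Lemma good_event : 0 < cb -> exists E : set Omega,
  [/\ measurable E, ((1 - (cb + 4) / n%:R ^+ 10)%:E <= P E)%E &
   forall w, E w ->
     [/\ \matrix_(i, j) H i j w = truncated H B w,
      forall s i j, (0 < s <= 2 * s0)%N -> `|(truncated H B w ^+ s) i j| <= K ^+ s
    & forall s i j, (0 < s <= 2 * s0)%N ->
      `|(U^T *m truncated H B w ^+ s *m U) i j| <= K ^+ s * V]].
Proof.
move=> cb0.
have n0 : 0 < n%:R :> R by rewrite ltr0n (ltn_trans _ n_gt1).
have [L2 Ls s3 sn] := ln_nat_bounds.
have KE : K = 2 * D * T by rewrite /K /D; ring.
have D0 : 0 < D by rewrite mulr_gt0 // N_gt0.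
(* Coordinate vectors make matrix entries bilinear forms, with 1 as the bound on the right vector.
   Below, indices in ['I_(2 * s0)] start at 0 and stand for the exponents from 1 on. *)
pose ev (i k : 'I_n) : R := (k == i)%:R.
pose I := (('I_n * 'I_n) + ('I_(2 * s0) * ('I_n * 'I_n)) +
           ('I_(2 * s0) * ('I_r * 'I_r)))%type.
pose f1 (x : 'I_(2 * s0) * ('I_n * 'I_n)) w :=
  bilinear (ev x.2.1) (truncated H B w ^+ x.1.+1) (ev x.2.2).
pose f2 (x : 'I_(2 * s0) * ('I_r * 'I_r)) w :=
  bilinear (U^~ x.2.1) (truncated H B w ^+ x.1.+1) (U^~ x.2.2).
pose bad (x : I) : set Omega := match x with
  | inl (inl ij) => [set w | (B < `|H ij.1 ij.2 w|)%R]
  | inl (inr y) => [set w | (K ^+ y.1.+1 * 1 <= `|f1 y w|)%R]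
  | inr y => [set w | (K ^+ y.1.+1 * V <= `|f2 y w|)%R]
  end.
pose c (x : I) : R := if x is inl (inl _) then cb / n%:R ^+ 12 else n%:R ^- 16.
have ev1 i : \sum_k ev i k ^+ 2 <= 1.
  rewrite (bigD1 i) //= big1 ?addr0 => [|k /negbTE ki]; rewrite /ev.
    by rewrite eqxx expr1n.
  by rewrite ki expr0n.
have evle i k : `|ev i k| <= 1.
  by rewrite /ev; case: (_ == _); rewrite ?normr1 ?normr0.
have U1 j : \sum_k U k j ^+ 2 <= 1.
  have := congr1 (fun A : 'M[R]_r => A j j) UU; rewrite !mxE eqxx mulr1n => <-.
  by apply: ler_sum => k _; rewrite !mxE expr2.
have mbad x : measurable (bad x).
  case: x => [[ij|y]|y] /=.
  - have mH : measurable_fun setT (fun w => `|H ij.1 ij.2 w|).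
      exact: measurableT_comp.
    have := mH measurableT _ (measurable_itv `]B, +oo[).
    rewrite setTI; congr (measurable _); apply/seteqP.
    by split=> w /=; rewrite in_itv /= andbT.
  - by apply: measurable_norm_ge; apply: bm_bilinear.
  - by apply: measurable_norm_ge; apply: bm_bilinear.
have [indep _ _ _] := noise.
have n00 : (0 < n)%N by apply: ltn_trans n_gt1.
have T0 : 0 < T by apply: expR_gt0.
have ntail : 0 <= cb / n%:R ^+ 12 by rewrite divr_ge0 ?exprn_ge0 ?(ltW cb0) ?(ltW n0).
have Pbad x : (P (bad x) <= (c x)%:E)%E.
  case: x => [[ij|y]|y].
  - case: (noise_tail ij.1 ij.2) => //= h.
    by apply: le_trans h _; rewrite lee_fin.
  - have hs : (0 < y.1.+1 <= 2 * s0)%N by rewrite ltnS leq0n ltn_ord.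
    have [e1 e2 e3] := exponent_conditions hs.
    rewrite /bad /c KE; apply: le_trans (_ : _ <= (T ^- (p y.1.+1 * y.1.+1))%:E)%E _; last first.
      by rewrite lee_fin.
    apply: (bilinear_tail B_gt0 n00 indep truncated_mean0 truncated_moment
      (ev1 y.2.1) (evle y.2.2)) => //.
    by rewrite /p oddM.
  - have hs : (0 < y.1.+1 <= 2 * s0)%N by rewrite ltnS leq0n ltn_ord.
    have [e1 e2 e3] := exponent_conditions hs.
    rewrite /bad /c KE; apply: le_trans (_ : _ <= (T ^- (p y.1.+1 * y.1.+1))%:E)%E _; last first.
      by rewrite lee_fin.
    apply: (bilinear_tail B_gt0 n00 indep truncated_mean0 truncated_moment
      (U1 y.2.1) (fun i => UV i y.2.2)) => //.
    by rewrite /p oddM.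
(* As [s0] and [r] are at most [n], the [2 * s0 * (n ^+ 2 + r ^+ 2)] tail events cost at most
   [4 * n%:R ^- 13], and the [n ^+ 2] truncation events cost [cb * n%:R ^- 10]. *)
have csum : \sum_x c x <= (cb + 4) / n%:R ^+ 10.
  rewrite big_sumType /= big_sumType /= !sumr_const !card_prod !card_ord.
  rewrite -2!(mulr_natl (n%:R ^- 16)) -(mulr_natl (cb / _)) !natrM.
  have sn' : s0%:R <= n%:R :> R by rewrite ler_nat.
  have rn : r%:R <= n%:R :> R by rewrite ler_nat.
  have n1 : 1 <= n%:R :> R by rewrite ler1n.
  have rr : r%:R * r%:R <= n%:R * n%:R :> R by rewrite ler_pM.
  have srr : s0%:R * (r%:R * r%:R) <= n%:R * (n%:R * n%:R) :> R.
    by rewrite ler_pM // mulr_ge0.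
  have snn : s0%:R * (n%:R * n%:R) <= n%:R * (n%:R * n%:R) :> R.
    by rewrite ler_wpM2r // mulr_ge0.
  have e16 : 0 <= n%:R ^- 16 :> R by rewrite invr_ge0 exprn_ge0 // ltW.
  have h1 := ler_wpM2r e16 srr; have h2 := ler_wpM2r e16 snn.
  have e1 : n%:R * (n%:R * n%:R) * n%:R ^- 16 <= n%:R ^- 10 :> R.
    have -> : n%:R * (n%:R * n%:R) * n%:R ^- 16 = n%:R ^- 10 * (n%:R ^+ 3)^-1 :> R.
      by field; rewrite gt_eqF.
    rewrite ler_piMr ?invr_ge0 ?exprn_ge0 ?(ltW n0) //.
    by rewrite invf_le1 ?exprn_gt0 // exprn_ege1.
  have -> : (cb + 4) / n%:R ^+ 10 = n%:R * n%:R * (cb / n%:R ^+ 12) + 4 * n%:R ^- 10.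
    by field; rewrite gt_eqF.
  by lra.
have [mE PE] := union_bound mbad Pbad csum.
exists [set w | forall x, ~ bad x w]; split=> // w Ew; split.
- apply/matrixP => i j; rewrite !mxE /truncate.
  by have /negP := Ew (inl (inl (i, j))); rewrite /= -leNgt => ->.
- move=> [//|s] i j /andP[_ hs].
  have /negP := Ew (inl (inr (Ordinal hs, (i, j)))); rewrite /= mulr1 -ltNge => /ltW.
  rewrite /f1 /bilinear /= (bigD1 i) //= [X in _ + X]big1 ?addr0; last first.
    move=> k /negbTE ki; apply: big1 => k' _.
    by rewrite /ev ki !mul0r.
  rewrite (bigD1 j) //= [X in _ + X]big1 ?addr0; last first.
    by move=> k /negbTE kj; rewrite /ev kj mulr0.
  by rewrite /ev !eqxx mul1r mulr1.
- move=> [//|s] i j /andP[_ hs].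
  have /negP := Ew (inr (Ordinal hs, (i, j))); rewrite /= -ltNge => /ltW.
  rewrite /f2 /bilinear /=; congr (`|_| <= _).
  rewrite exchange_big /= mxE; apply: eq_bigr => k _.
  rewrite mxE mulr_suml; apply: eq_bigr => k' _.
  by rewrite mxE.
Qed.

End GoodEvent.

(** * Choice of constants and combination of the probabilistic and deterministic bounds *)

Theorem corollary5 (R : realType) (cb : R) (cb_gt0 : 0 < cb) :
  exists c1 C C' : R, [/\ 0 < c1, 0 < C & 0 < C'] /\
  forall (d : measure_display) (Omega : measurableType d)
    (P : probability Omega R) (n r : nat)
    (Mstar : 'M[R]_n) (Ustar : 'M[R]_(n, r)) (lamstar : r.-tuple R) (mu : R)
    (sigma B : R) (H : 'I_n -> 'I_n -> {RV P >-> R}),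
  let lmax := `|head 0 lamstar| in
  let lmin := `|last 0 lamstar| in
  let kappa := lmax / lmin in
  let M := fun w : Omega => Mstar + \matrix_(i, j) H i j w in
  Mstar^T = Mstar ->
  \rank Mstar = r ->
  eigen_decomposition Mstar Ustar lamstar ->
  incoherence_parameter Ustar mu ->
  0 <= sigma ->
  0 < B ->
  noise_assumption cb sigma B H ->
  noise_level n sigma B / lmax <= c1 / kappa ^+ 2 ->
  forall (lam : Omega -> r.-tuple R[i]),
  (forall w, top_eigenvalues (M w) (lam w)) ->
  forall l : 'I_r,
  exists E : set Omega,
    [/\ measurable E,
        ((1 - C' / n%:R ^+ 10)%:E <= P E)%E
      & forall w, E w -> exists j : 'I_r,
          `|tnth (lam w) l - (tnth lamstar j)%:C| <=
            (C * noise_level n sigma B * kappa * r%:R *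
             Num.sqrt (mu / n%:R))%:C].
Proof.
(* With [Q = expR 1] and [K = 36 * expR 8 * N], the quantity [Q ^+ 2 * K] of [top_eigenvalue_near]
   is [k0 * N]; its factors 16 and 32 then dictate [c1] and [C], and [good_event] dictates [C']. *)
pose k0 : R := expR 1 ^+ 2 * (36 * expR 8).
have k00 : 0 < k0 by rewrite !mulr_gt0 ?exprn_gt0 ?expR_gt0.
exists (16 * k0)^-1, (32 * k0), (cb + 4); split.
  by split; rewrite ?invr_gt0 ?mulr_gt0 ?addr_gt0.
move=> d Omega P n r Mstar Ustar lamstar mu sigma B H lmax lmin kappa M.
move=> _ rkM eigM [[mu0 hmu] _] sigma0 B0 noise hN lam hlam l.
have rn : (r <= n)%N by rewrite -rkM rank_leq_row.
have r0 : (0 < r)%N := leq_ltn_trans (leq0n l) (ltn_ord l).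
have n0 := leq_trans r0 rn.
(* For [n = 1] the logarithm vanishes, but the required probability [1 - (cb + 4)] is negative and
   the empty event suffices. *)
have [n1|n1] := leqP n 1.
  exists set0; split=> //; rewrite measure0 lee_fin subr_le0.
  have -> : n = 1%N by apply/eqP; rewrite eqn_leq n1.
  by rewrite expr1n divr1; lra.
have [UU _ lam0 lams] := eigM.
set V := Num.sqrt (mu / n%:R) in hmu *.
(* If [V] were 0, column [l] of [Ustar] would vanish, against orthonormality. *)
have V0 : 0 < V.
  rewrite lt_def sqrtr_ge0 andbT; apply/eqP => V0.
  have := congr1 (fun A : 'M[R]_r => A l l) UU; rewrite !mxE eqxx mulr1n big1.
    by move/esym/eqP; rewrite oner_eq0.
  move=> i _; have := hmu i l; rewrite V0 normr_le0 => /eqP ->.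
  by rewrite mulr0.
have [E [mE PE hE]] := good_event n1 rn sigma0 B0 noise UU hmu V0 cb_gt0.
exists E; split=> // w Ew.
have [HE h1 h2] := hE w Ew.
have NN := N_gt0 sigma n1 B0.
set N := noise_level n sigma B in hN NN h1 h2 *.
have [L2 Ls s3 sn] := ln_nat_bounds R n1.
set s0 := (Num.truncn (ln n%:R : R)).+1 in h1 h2 Ls s3 sn *.
have bnd := sorted_norm_bounds lams.
have lmin0 : 0 < lmin.
  rewrite /lmin normr_gt0 -nth_last.
  have hr : (r.-1 < r)%N by rewrite ltn_predL.
  by have := lam0 (Ordinal hr); rewrite (tnth_nth 0) /= size_tuple.
have lmm : lmin <= lmax by have /andP[b1 b2] := bnd l; apply: le_trans b1 b2.
have lmax0 : 0 < lmax by apply: lt_le_trans lmm.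
have kap0 : 0 < kappa by rewrite divr_gt0.
have K0 : 0 < 36 * expR 8 * N by rewrite !mulr_gt0 // expR_gt0.
have Q1 : 1 <= expR 1 :> R by rewrite -expR0 ler_expR.
have nQ : n%:R <= expR 1 ^+ s0 :> R.
  rewrite -expRM_natl mulr1 -[leLHS]lnK ?posrE ?ltr0n // ler_expR.
  exact: Ls.
(* As [lmax / kappa = lmin], multiplying the noise hypothesis by [lmax * kappa] gives
   [N * kappa <= lmin / (16 * k0)]. *)
have kk : 16 * (expR 1 ^+ 2 * (36 * expR 8 * N)) * kappa <= lmin.
  have -> : 16 * (expR 1 ^+ 2 * (36 * expR 8 * N)) * kappa =
      16 * k0 * (N * kappa) by rewrite /k0; ring.
  rewrite mulrC -ler_pdivlMr ?mulr_gt0 //.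
  move: hN; rewrite ler_pdivrMr // => hN.
  have := ler_wpM2r (ltW kap0) hN.
  have -> // : (16 * k0)^-1 / kappa ^+ 2 * lmax * kappa = lmin / (16 * k0).
  by rewrite /kappa; field; rewrite !gt_eqF.
have := hlam w; rewrite /M HE => top.
have [j hj] := top_eigenvalue_near l eigM hmu n0 (ltn0Sn _) K0 Q1 nQ h1 h2 kk top.
exists j; apply: le_trans hj _; rewrite lecR.
by rewrite le_eqVlt; apply/orP; left; apply/eqP; rewrite -/lmax -/lmin -/kappa /k0; ring.
Qed.
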